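(* Let $k,N\ge1$ be integers and let $m$ be an integer. Then $I_k(m;N)$ is equal to the number of lattice points $x=(x_i^{(j)})_{1\le i,j\le k}\in\mathbb Z^{k^2}$ satisfying each of the following relations: 1. $0\le x_i^{(j)}\le N$ for all $1\le i,j\le k$; 2. $x_1^{(k)}+x_2^{(k-1)}+\cdots+x_k^{(1)}=kN-m$; 3. $x\in A_k$, where $A_k$ is the collection of $k\times k$ matrices $(x_i^{(j)})$ (row index $i$, column index $j$) whose entries are weakly increasing along each row and weakly decreasing down each column, i.e. $x_i^{(j)}\le x_i^{(j+1)}$ for $1\le i\le k$, $1\le j\le k-1$, and $x_{i+1}^{(j)}\le x_i^{(j)}$ for $1\le i\le k-1$, $1\le j\le k$.
   Context: For an $N\times N$ matrix $U$, the secular coefficients $\operatorname{Sc}_j(U)$ are defined by $\det(I+xU)=\sum_{j=0}^N \operatorname{Sc}_j(U)x^j$. With $U(N)$ the group of $N\times N$ unitary matrices and $dU$ its Haar probability measure, define $$I_k(m;N)=\int_{U(N)}\Big|\sum_{\substack{j_1+\cdots+j_k=m\\ 0\le j_1,\dots,j_k\le N}}\operatorname{Sc}_{j_1}(U)\cdots\operatorname{Sc}_{j_k}(U)\Big|^2\,dU .$$ *)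

(* Defs.v *)
From HB Require Import structures.
From mathcomp Require Import all_boot all_order all_algebra.
From mathcomp Require Import complex finmap.
From mathcomp Require Import all_classical all_reals all_analysis.
Import numFieldNormedType.Exports.

Set Implicit Arguments.
Unset Strict Implicit.
Unset Printing Implicit Defensive.

Import Order.TTheory GRing.Theory Num.Theory.

Local Open Scope ring_scope.
Local Open Scope classical_set_scope.
Local Open Scope complex_scope.

(* [R[i]] itself carries no canonical topology; its regular module [R[i]^o]
   (convertible to it) does, namely the one given by the complex modulus. *)
Definition unitary_set (R : realType) (N : nat) : set 'M[R[i]^o]_N :=
  [set U : 'M[R[i]]_N | U \is unitarymx].

(* [set_type] is the subtype, with the subspace topology. *)
Definition unitary_group (R : realType) (N : nat) : Type :=
  set_type (@unitary_set R N).

HB.instance Definition _ (R : realType) (N : nat) :=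
  Topological.on (unitary_group R N).

Definition unitary_mx (R : realType) (N : nat) (U : unitary_group R N) :
  'M[R[i]]_N := \val U.

Lemma unitary_mxP (R : realType) (N : nat) (U : unitary_group R N) :
  unitary_mx U \is unitarymx.
Proof. exact: (set_mem (valP U)). Qed.

Definition unitary_of (R : realType) (N : nat) (U : 'M[R[i]]_N)
    (hU : U \is unitarymx) : unitary_group R N :=
  exist _ (U : 'M[R[i]^o]_N) (mem_set (hU : @unitary_set R N U)).

Lemma unitary1 (R : realType) (N : nat) : (1%:M : 'M[R[i]]_N) \is unitarymx.
Proof. by apply/unitarymxP; rewrite trmx1 map_mx1 mulmx1. Qed.

HB.instance Definition _ (R : realType) (N : nat) :=
  isPointed.Build (unitary_group R N) (unitary_of (unitary1 R N)).

Definition unitary_mul (R : realType) (N : nat) (V U : unitary_group R N) :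
    unitary_group R N :=
  unitary_of (mul_unitarymx (unitary_mxP V) (unitary_mxP U)).

Definition borel_unitary (R : realType) (N : nat) :
    measurableType (@open (unitary_group R N)).-sigma :=
  g_sigma_algebraType (@open (unitary_group R N)).

(* Left invariance together with total mass 1 determines mu uniquely, and U(N)
   being compact, mu is then right invariant too. *)
Definition is_haar (R : realType) (N : nat)
    (mu : probability (borel_unitary R N) R) : Prop :=
  forall (V : borel_unitary R N) (A : set (borel_unitary R N)),
    measurable A -> mu [set unitary_mul V U | U in A] = mu A.

Definition secular (R : realType) (N : nat) (j : nat) (U : 'M[R[i]]_N) : R[i] :=
  (\det (1%:M + 'X *: map_mx polyC U))`_j.

Definition secular_sum (R : realType) (N k : nat) (m : int) (U : 'M[R[i]]_N) :
    R[i] :=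
  \sum_(j : {ffun 'I_k -> 'I_N.+1} | (\sum_(a < k) (j a : nat))%N%:Z == m)
    \prod_(a < k) secular (j a) U.

Definition secular_moment (R : realType) (N : nat)
    (mu : probability (borel_unitary R N) R) (k : nat) (m : int) : \bar R :=
  (\int[mu]_U ((Normc.normc (secular_sum k m (unitary_mx U))) ^+ 2)%:E)%E.

(* [x i j] stands for x_(i+1)^(j+1): lower index = row, upper index = column. *)
Definition is_monotone_mx (k : nat) (x : 'M[int]_k) : Prop :=
  (forall i j j' : 'I_k, j' = j.+1 :> nat -> x i j <= x i j') /\
  (forall i i' j : 'I_k, i' = i.+1 :> nat -> x i' j <= x i j).

Definition lattice_points (k N : nat) (m : int) : set 'M[int]_k :=
  [set x : 'M[int]_k | [/\ forall i j, 0 <= x i j <= N%:Z,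
               \sum_(i < k) x i (rev_ord i) = (k * N)%N%:Z - m
             & is_monotone_mx x]].

(* In particular [fset_set] does not take its default value on this set. *)
Lemma finite_lattice_points (k N : nat) (m : int) :
  finite_set (@lattice_points k N m).
Proof.
pose f (y : 'M['I_N.+1]_k) : 'M[int]_k := \matrix_(i, j) (nat_of_ord (y i j))%:Z.
apply: (@sub_finite_set _ _ (f @` setT)); last exact/finite_image/finite_finset.
move=> x [x_bnd _ _]; exists (\matrix_(i, j) inord `|x i j|%N) => //.
apply/matrixP => i j; rewrite !mxE; have /andP[x0 xN] := x_bnd i j.
by rewrite inordK ?gez0_abs// ltnS -lez_nat gez0_abs.
Qed.

(* Main.v *)
Require Import Defs.
From HB Require Import structures.
From mathcomp Require Import all_boot all_order all_fingroup all_algebra.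
From mathcomp Require Import -(notations) mpoly.
From mathcomp Require Import ring zify.

(** Write e_p for the p-th secular coefficient of U. On U(N) the conjugate of
    e_p is the conjugate of det U times e_(N-p) (conj_sec), so the moment is a
    sum of integrals
      M(p) = int e_(p_1) ... e_(p_2k) (conj det U)^k dU,   |p| = kN,
    over the contents p whose first k entries add up to kN - m.

    These integrals are pinned down by a recursion. A complex reflection
    A = 1 + (z - 1) v v^* / |v|^2 changes every e_p(U) by an affine function of
    z when U is replaced by AU. Invariance of the Haar measure under A, read
    off at order two in z - 1 and averaged over finitely many vectors v, gives
    a quadratic Casimir relation (moment_casimir). It involves the traces of
    products T_p T_q, where T_p is the coefficient of x^p in x U adj(1 + xU);
    such a trace is a quadratic expression in the e_p (mxtrace_newtonM), and
    the relation becomes linear between M(p) and the values of M at contents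
    in which two entries p_a, p_b have been moved apart (moment_rec). The
    coefficient of M(p) vanishes only if all entries of p are 0 or N, so that
    downward induction on the sum of the p_a^2 leaves one solution with given
    values at these extreme contents (exchange_rec_eq0); there M(p) = 1, the
    integrand being |det U|^(2k).

    A second solution is the coefficient of x^(delta + k) in the product of the
    Vandermonde alternant a_delta with the elementary symmetric polynomials
    e_(p_c)(x_1, .., x_N) (kostka). It satisfies the same relation because
    a_delta and every monomial are eigenvectors of the sum of the (x_i d/dx_i)^2
    while the mixed terms are governed by one subset of indices only
    (kostka_rec). Hence M is this coefficient (moment_kostka).

    Multiplying an alternant by e_p adds a vertical strip to its exponents
    (alt_elem), and alternants with a repeated exponent vanish. So the
    coefficient counts the chains of partitions from the empty one to (k^N)
    whose 2k steps are vertical strips of sizes p_c (kostka_chain). Such a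
    chain is a family of N nested lattice paths in a k by k square, and
    stacking the regions below the paths gives a monotone matrix with entries
    between 0 and N, whose antidiagonal sum is the size of the k-th partition
    (box, unbox, box_diag). *)

Set Implicit Arguments.
Unset Strict Implicit.
Unset Printing Implicit Defensive.
Import Order.TTheory GRing.Theory Num.Theory.

Local Open Scope ring_scope.

(** * Secular coefficients of a matrix and of its rank one multiples *)

Lemma derivation_prod (R : comNzRingType) (d : R -> R)
    (dM : forall f g, d (f * g) = d f * g + f * d g)
    (I : finType) (P : pred I) (f : I -> R) :
  d (\prod_(i | P i) f i) =
  \sum_(i | P i) d (f i) * \prod_(j | P j && (j != i)) f j.
Proof.
have d1 : d 1 = 0.
  apply: (addrI (d 1)); rewrite addr0; apply/esym.
  by have := dM 1 1; rewrite !mulr1 mul1r.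
have := index_enum_uniq I; elim: (index_enum I) => [|x r IH].
  by rewrite !big_nil d1.
rewrite cons_uniq => /andP[xr ur]; rewrite !big_cons eqxx andbF.
have drop F : \sum_(i <- r | P i) F i * \prod_(j <- x :: r | P j && (j != i)) f j
    = \sum_(i <- r | P i) F i *
        ((if P x then f x else 1) * \prod_(j <- r | P j && (j != i)) f j).
  rewrite [LHS]big_seq_cond [RHS]big_seq_cond; apply: eq_bigr => i /andP[ir _].
  rewrite big_cons; have -> : x != i by apply: contraNneq xr => ->.
  by rewrite andbT; case: (P x); rewrite ?mul1r.
rewrite drop; case: (P x); last first.
  by rewrite IH//; apply: eq_bigr => i _; rewrite mul1r.
rewrite dM IH//; congr (_ * _ + _).
  rewrite big_seq_cond [RHS]big_seq_cond; apply: eq_bigl => j.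
  by case: (boolP (j \in r)) => //= jr; rewrite andbC; case: eqP xr jr => // -> /negPf->.
by rewrite mulr_sumr; apply: eq_bigr => i _; rewrite mulrCA.
Qed.

Lemma derivation2_prod (R : comNzRingType) (d : {additive R -> R})
    (dM : forall f g, d (f * g) = d f * g + f * d g)
    (I : finType) (f : I -> R) :
  d (d (\prod_i f i)) =
  \sum_i d (d (f i)) * \prod_(j | j != i) f j +
  \sum_i \sum_(j | j != i) d (f i) * d (f j) *
     \prod_(l | (l != i) && (l != j)) f l.
Proof.
rewrite derivation_prod// raddf_sum -big_split /=; apply: eq_bigr => i _.
rewrite dM (derivation_prod dM) mulr_sumr; congr (_ + _).
by apply: eq_bigr => j _; rewrite mulrA.
Qed.

(** The Leibniz rule differentiates one row of A at a time; expanding along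
    that row produces the cofactors. *)
Lemma deriv_det (R : comNzRingType) n (A : 'M[{poly R}]_n) :
  (\det A)^`() = \tr (map_mx (@deriv R) A *m \adj A).
Proof.
pose B i := \matrix_(i', j) if i' == i then (A i' j)^`() else A i' j.
transitivity (\sum_i \det (B i)).
  rewrite /determinant raddf_sum exchange_big /=; apply: eq_bigr => s _.
  rewrite -signr_odd; set sg : {poly R} := (-1) ^+ _.
  have -> : sg = ((-1) ^+ odd (perm.odd_perm s))%:P by rewrite /sg; case: (odd _); rewrite ?expr0// expr1 polyCN.
  rewrite mul_polyC derivZ (derivation_prod (@derivM R)) scaler_sumr; apply: eq_bigr => i _.
  rewrite mul_polyC; congr (_ *: _); rewrite [RHS](bigD1 i)//= mxE eqxx.
  by congr (_ * _); apply: eq_big => // j ji; rewrite mxE (negPf ji).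
apply: eq_bigr => i _; rewrite (expand_det_row _ i) !mxE.
apply: eq_bigr => j _; rewrite !mxE eqxx; congr (_ * _).
rewrite /cofactor; congr (_ * _); congr (\det _); apply/matrixP=> a b.
by rewrite !mxE eq_sym (negPf (neq_lift _ _)).
Qed.

(** The bordered matrix M with corner 1 has determinant det (A + uv) by row
    elimination. Multiplied by a matrix of determinant det A it becomes block
    triangular, which gives the right-hand side times det A. *)
Lemma det_rank1 (R : idomainType) n (A : 'M[R]_n) (u : 'cV_n) (v : 'rV_n) :
  \det A != 0 -> \det (A + u *m v) = \det A + (v *m \adj A *m u) 0 0.
Proof.
move=> dA.
pose M := block_mx (1%:M : 'M[R]_1) v (- u) A.
have M1 : \det M = \det (A + u *m v).
  have := congr1 (@determinant _ _) (mulmx_block (1%:M : 'M[R]_1) 0 u (1%:M) 1%:M v (-u) A).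
  rewrite det_mulmx det_lblock !det1 !mul1r => ->.
  rewrite !mul1mx !mul0mx !addr0 mulmx1 subrr det_ublock det1 mul1r.
  by rewrite addrC.
apply: (mulIf dA); rewrite -M1.
have := congr1 (@determinant _ _) (mulmx_block (1%:M : 'M[R]_1) v (- u) A (\det A)%:M 0 (\adj A *m u) 1%:M).
rewrite det_mulmx det_lblock det1 mulr1 det_scalar expr1 => ->.
rewrite !mul1mx !mulmx1 !mulmxA mul_mx_adj !mulmx0 !add0r.
rewrite mulNmx scalar_mxC addNr.
by rewrite det_ublock [X in \det X * _]mx11_scalar det_scalar1 !mxE eqxx mulr1n.
Qed.

Section Secular.
Variables (R : comNzRingType) (N : nat).
Implicit Types (U : 'M[R]_N) (p q : nat).

Definition sec U p : R := (\det (1%:M + 'X *: map_mx polyC U))`_p.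

(** This is the coefficient of x^p in x U adj(1 + xU), see newton_mx_adj. The
    recursion shows that its entries are polynomials in those of U. *)
Fixpoint newton_mx U p : 'M[R]_N :=
  if p is p'.+1 then (sec U p') *: U - U *m newton_mx U p' else 0.

(** Comparing coefficients in (1 + xU) adj(1 + xU) = det (1 + xU) gives the
    recursion. *)
Lemma newton_mx_adj U p :
  newton_mx U p.+1 =
  U *m map_mx (coefp p) (\adj (1%:M + 'X *: map_mx polyC U)).
Proof.
set A := 1%:M + _; set B := \adj A.
have step q : map_mx (coefp q.+1) B + U *m map_mx (coefp q) B = (sec U q.+1)%:M.
  have /matrixP E : A *m B = (\det A)%:M by exact: mul_mx_adj.
  apply/matrixP => i j; have /(congr1 (coefp q.+1)) := E i j.
  rewrite /A mulmxDl mul1mx -scalemxAl !mxE /=.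
  rewrite coefD coefXM /= coef_sum coefMn /sec => <-.
  by congr (_ + _); apply: eq_bigr => l _; rewrite !mxE coefCM.
have step0 : map_mx (coefp 0) B = (sec U 0)%:M.
  have /matrixP E : A *m B = (\det A)%:M by exact: mul_mx_adj.
  apply/matrixP => i j; have /(congr1 (coefp 0)) := E i j.
  by rewrite /A mulmxDl mul1mx -scalemxAl !mxE /= coefD coefXM /= coefMn addr0.
elim: p => [|p IH]; first by rewrite /= mulmx0 subr0 step0 mul_mx_scalar.
have -> : map_mx (coefp p.+1) B = (sec U p.+1)%:M - newton_mx U p.+1.
  by rewrite -step IH addrK.
by rewrite mulmxBr mul_mx_scalar.
Qed.

(** Newton's identity: the generating function of the traces is x times the
    derivative of det (1 + xU). *)
Lemma mxtrace_newton U p : \tr (newton_mx U p) = (sec U p) *+ p.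
Proof.
case: p => [|p]; first by rewrite mulr0n mxtrace0.
rewrite newton_mx_adj -coef_deriv deriv_det.
rewrite /mxtrace coef_sum; apply: eq_bigr => i _; rewrite !mxE coef_sum.
apply: eq_bigr => j _; rewrite !mxE derivD derivM derivX derivC mulr0 addr0 mul1r.
by rewrite derivMn derivC mul0rn add0r coefCM.
Qed.

Lemma newton_mx_comm U p : U *m newton_mx U p = newton_mx U p *m U.
Proof.
elim: p => [|p IH] /=; first by rewrite mulmx0 mul0mx.
by rewrite mulmxBr mulmxBl -scalemxAr -scalemxAl -mulmxA -IH.
Qed.

Lemma newton_mx_step U p q :
  newton_mx U p.+1 *m newton_mx U q =
  newton_mx U p *m newton_mx U q.+1
  + sec U q *: newton_mx U p.+1 - sec U p *: newton_mx U q.+1.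
Proof.
have comm := newton_mx_comm U p.
rewrite /= mulmxBl mulmxBr -!scalemxAl -!scalemxAr.
rewrite (mulmxA (newton_mx U p)) -comm.
set B := U *m newton_mx U p. set C := U *m newton_mx U q. set A := B *m _.
by apply/matrixP => i j; rewrite !mxE; ring.
Qed.

Let mxtraceB (A B : 'M[R]_N) : \tr (A - B) = \tr A - \tr B.
Proof. by rewrite raddfB. Qed.

(** Repeated use of newton_mx_step lowers the smaller index to 0, where the
    product vanishes; each step contributes traces of single matrices only. *)
Lemma mxtrace_newtonM U p q :
  \tr (newton_mx U p *m newton_mx U q) =
  (sec U p * sec U q) *+ minn p q +
  \sum_(i < minn p q)
     (sec U i * sec U (p + q - i)) * ((2 * i)%:R - (p + q)%:R).
Proof.
wlog pq : p q / (p <= q)%N.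
  move=> H; case/orP: (leq_total p q) => /H // E.
  by rewrite mxtrace_mulC E minnC [sec U q * _]mulrC addnC.
rewrite (minn_idPl pq).
elim: p q pq => [|p IH] q pq; first by rewrite /= mul0mx mxtrace0 mulr0n big_ord0 addr0.
rewrite newton_mx_step mxtraceB mxtraceD IH; last by lia.
rewrite !mxtraceZ !mxtrace_newton big_ord_recr /= -addSnnS.
have -> : (p.+1 + q - p = q.+1)%N by lia.
move: (\sum_(i < p) _) => S.
rewrite -[_ *+ p.+1]mulr_natr -[_ *+ q.+1]mulr_natr -[(_ * _) *+ p]mulr_natr.
move: (sec U p) (sec U q) (sec U p.+1) (sec U q.+1) => a b c d.
rewrite natrM addSn -(addn1 p) -(addn1 q) -(addn1 (p + q)).
rewrite -[c * b *+ _]mulr_natr !natrD.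
move: (p%:R) (q%:R) => x y.
ring.
Qed.

End Secular.

Lemma det_secular_neq0 (R : idomainType) N (U : 'M[R]_N) :
  \det (1%:M + 'X *: map_mx polyC U) != 0 :> {poly R}.
Proof.
apply/eqP => /(congr1 (horner_eval 0)); rewrite -[LHS](det_map_mx) horner_evalE horner0.
rewrite map_mxD map_mx1 map_mxZ /= horner_evalE hornerX scale0r addr0 det1.
by move/eqP; rewrite oner_eq0.
Qed.

(** The determinant is affine along rank one perturbations, and the slope is
    the adjugate evaluated at the perturbation. *)
Lemma sec_rank1 (R : idomainType) N (U : 'M[R]_N) (u : 'cV_N) (w : 'rV_N) t p :
  sec ((1%:M + t *: (u *m w)) *m U) p =
  sec U p + t * (w *m newton_mx U p *m u) 0 0.
Proof.
rewrite /sec.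
have -> : 1%:M + 'X *: map_mx polyC ((1%:M + t *: (u *m w)) *m U) =
   1%:M + 'X *: map_mx polyC U +
   (('X * t%:P) *: map_mx polyC u) *m (map_mx polyC (w *m U)).
  rewrite mulmxDl mul1mx map_mxD scalerDr addrA; congr (_ + _).
  rewrite -scalemxAl map_mxZ scalerA -scalemxAl -map_mxM mulmxA /=.
  by congr (_ *: _).
rewrite det_rank1 ?det_secular_neq0// coefD; congr (_ + _).
rewrite -scalemxAr mxE -mulrA coefXM coefCM.
case: p => [|p]; first by rewrite /= mulmx0 mul0mx mxE mulr0.
rewrite newton_mx_adj /=; congr (_ * _).
rewrite [in RHS]mulmxA !mxE coef_sum; apply: eq_bigr => i _.
rewrite !mxE coefMC; congr (_ * _); rewrite coef_sum; apply: eq_bigr => j _.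
by rewrite !mxE coefCM.
Qed.

(** * A recursion on contents with a unique solution *)

(** The entries p a and p b are replaced by i and p a + p b - i: for i smaller
    than both entries they move apart while their sum is kept. *)
Definition transfer n (p : {ffun 'I_n -> nat}) (a b : 'I_n) (i : nat) :
    {ffun 'I_n -> nat} :=
  [ffun c => if c == a then i else if c == b then (p a + p b - i)%N else p c].

Lemma bigD2 (V : Type) (idx : V) (op : Monoid.com_law idx) (I : finType)
    (a b : I) (F : I -> V) :
  a != b -> \big[op/idx]_c F c =
  op (op (F a) (F b)) (\big[op/idx]_(c | (c != a) && (c != b)) F c).
Proof.
by move=> ab; rewrite (bigD1 a)//= (bigD1 b) 1?eq_sym//= Monoid.mulmA.
Qed.

Lemma big_transfer (V : Type) (idx : V) (op : Monoid.com_law idx) n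
    (p : {ffun 'I_n -> nat}) a b i (F : nat -> V) :
  a != b -> \big[op/idx]_c F (transfer p a b i c) =
  op (op (F i) (F (p a + p b - i)%N))
     (\big[op/idx]_(c | (c != a) && (c != b)) F (p c)).
Proof.
move=> ab; rewrite (bigD2 _ _ ab) !ffunE !eqxx eq_sym (negPf ab).
by congr (op _ _); apply: eq_bigr => c /andP[ca cb]; rewrite ffunE (negPf ca) (negPf cb).
Qed.

Lemma transfer_sum n (p : {ffun 'I_n -> nat}) a b i :
  a != b -> (i < minn (p a) (p b))%N ->
  (\sum_c transfer p a b i c = \sum_c p c)%N.
Proof.
move=> ab im; rewrite (big_transfer _ p i id ab) (bigD2 _ p ab) /=.
by congr (_ + _)%N; lia.
Qed.

Lemma transfer_sumsq n (p : {ffun 'I_n -> nat}) a b i :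
  a != b -> (i < minn (p a) (p b))%N ->
  (\sum_c p c ^ 2 < \sum_c (transfer p a b i c) ^ 2)%N.
Proof.
move=> ab im.
rewrite (big_transfer _ p i (fun x => x ^ 2)%N ab) (bigD2 _ (fun c => p c ^ 2)%N ab) /=.
rewrite ltn_add2r; move: im; move: (p a) (p b) => x y im.
have [d dE] : exists d, (y = i + d.+1)%N by exists (y - i).-1; lia.
have [e eE] : exists e, (x = i + e.+1)%N by exists (x - i).-1; lia.
have -> : (x + y - i = i + (d + e).+2)%N by lia.
rewrite dE eE; nia.
Qed.

(** With h t the number of entries exceeding t, the double sum of the minima
    is the sum of the h t ^ 2, and the h t add up to kN; the bound is
    Cauchy-Schwarz over the N values of t. *)
Lemma sum_min_ge (n k N : nat) (p : 'I_n -> nat) :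
  (forall c, p c <= N)%N -> (\sum_c p c = k * N)%N ->
  (k * k * N <= \sum_a \sum_b minn (p a) (p b))%N.
Proof.
move=> pN sp; pose h t := (\sum_a (t < p a))%N.
have ind x : (x <= N)%N -> (\sum_(t < N) (t < x) = x)%N.
  move=> xN; rewrite -[RHS](card_ord x) -sum1_card (big_ord_widen N (fun=> 1%N))//.
  by rewrite [RHS]big_mkcond; apply: eq_bigr => t _; case: (_ < _)%N.
have -> : (\sum_a \sum_b minn (p a) (p b) = \sum_(t < N) h t ^ 2)%N.
  rewrite (eq_bigr (fun a => \sum_(t < N) (t < p a) * h t)%N); last first.
    move=> a _; under eq_bigr => b _ do rewrite -(ind _ (leq_trans (geq_minl _ _) (pN a))).
    rewrite exchange_big /=; apply: eq_bigr => t _; rewrite big_distrr /=.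
    by apply: eq_bigr => b _; rewrite leq_min mulnb.
  by rewrite exchange_big /=; apply: eq_bigr => t _; rewrite -big_distrl.
have hs : (\sum_(t < N) h t = k * N)%N.
  rewrite -sp exchange_big /=; apply: eq_bigr => a _; exact: ind.
have : (\sum_(t < N) 2 * k * h t <= \sum_(t < N) (h t ^ 2 + k ^ 2))%N.
  by apply: leq_sum => t _; rewrite -mulnA addnC; apply: (nat_Cauchy k (h t)).
rewrite -big_distrr /= hs big_split /= sum_nat_const card_ord; nia.
Qed.

(** The double sum over all pairs is at least (kN)^2 + k^2 N. Its diagonal,
    the sum of the p a ^ 2 + p a, is at most kN^2 + kN, with equality only if
    every entry is 0 or N. *)
Lemma excess_gt (n k N : nat) (p : 'I_n -> nat) :
  (forall c, p c <= N)%N -> (\sum_c p c = k * N)%N ->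
  ~~ [forall c, (p c == 0%N) || (p c == N)] ->
  (k * k.-1 * (N * N.+1) < \sum_a \sum_(b | b != a) (p a * p b + minn (p a) (p b)))%N.
Proof.
move=> pN sp nex.
have H1 := sum_min_ge pN sp.
have H2 : (\sum_c p c ^ 2 < k * N * N)%N.
  rewrite -sp big_distrl /=; move: nex; rewrite negb_forall => /existsP[c].
  rewrite negb_or => /andP[c0 cN]; rewrite (bigD1 c)//= [ltnRHS](bigD1 c)//=.
  rewrite -addSn leq_add//; first by have := pN c; move: c0 cN; nia.
  by apply: leq_sum => d _; rewrite -mulnn leq_mul2l pN orbT.
have H3 : (\sum_a \sum_b (p a * p b + minn (p a) (p b)) =
   k * N * (k * N) + \sum_a \sum_b minn (p a) (p b))%N.
  rewrite -{1}sp big_distrl /= -big_split; apply: eq_bigr => a _ /=.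
  by rewrite big_split /= -big_distrr /= sp.
have H4 : (\sum_a \sum_b (p a * p b + minn (p a) (p b)) =
   \sum_a \sum_(b | b != a) (p a * p b + minn (p a) (p b)) + \sum_a p a ^ 2 + k * N)%N.
  rewrite -sp -addnA -big_split -big_split; apply: eq_bigr => a _ /=.
  by rewrite (bigD1 a)//= minnn mulnn addnC.
case: k sp H1 H2 H3 H4 => [|k] /= sp H1 H2 H3 H4; first by nia.
nia.
Qed.

(** The shape taken by the quadratic Casimir relation once the traces are
    written in terms of products of secular coefficients. *)
Definition exchange_rec (F : comNzRingType) n k N (M : {ffun 'I_n -> nat} -> F)
    (p : {ffun 'I_n -> nat}) :=
  \sum_a \sum_(b | b != a) ((p a * p b + minn (p a) (p b))%:R * M p +
    \sum_(i < minn (p a) (p b)) ((2 * i)%:R - (p a + p b)%:R) * M (transfer p a b i))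
  = (k * k.-1 * (N * N.+1))%:R * M p.

(** All contents other than p in the relation at p have a larger sum of
    squares, which is bounded by (kN)^2, and by excess_gt the coefficients of
    M p on the two sides differ unless every entry is 0 or N. *)
Lemma exchange_rec_eq0 (F : numFieldType) n k N
    (M : {ffun 'I_n -> nat} -> F) :
  (forall p : {ffun 'I_n -> nat}, (exists c, N < p c)%N -> M p = 0) ->
  (forall p : {ffun 'I_n -> nat}, (\sum_c p c = k * N)%N -> (forall c, p c = 0 \/ p c = N)%N -> M p = 0) ->
  (forall p : {ffun 'I_n -> nat}, (\sum_c p c = k * N)%N ->
     (forall c, p c <= N)%N -> exchange_rec k N M p) ->
  forall p : {ffun 'I_n -> nat}, (\sum_c p c = k * N)%N -> M p = 0.
Proof.
move=> Mbig Mext Mrec p.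
have [h] := ubnP ((k * N) ^ 2 - \sum_c p c ^ 2)%N.
elim: h p => // h IH p ph sp.
have [/existsP|/existsPn pN] := boolP [exists c, N < p c]%N; first exact: Mbig.
have {}pN c : (p c <= N)%N by rewrite leqNgt.
have [/forallP ex|nex] := boolP [forall c, (p c == 0%N) || (p c == N)].
  by apply: Mext => // c; have /orP[/eqP->|/eqP->] := ex c; [left|right].
have sq (q : {ffun 'I_n -> nat}) : (\sum_c q c = k * N)%N -> (\sum_c q c ^ 2 <= (k * N) ^ 2)%N.
  move=> sq; rewrite -mulnn -[in leqRHS]sq big_distrl /=; apply: leq_sum => c _.
  by rewrite -mulnn leq_mul2l (bigD1 c)//= leq_addr orbT.
have := Mrec p sp pN; rewrite /exchange_rec.
rewrite [X in X = _](eq_bigr (fun a =>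
    (\sum_(b | b != a) (p a * p b + minn (p a) (p b)))%:R * M p)); last first.
  move=> a _; rewrite natr_sum mulr_suml; apply: eq_bigr => b.
  rewrite eq_sym => ab; rewrite big1 ?addr0// => i _.
  have sp' := etrans (transfer_sum ab (ltn_ord i)) sp.
  rewrite IH ?mulr0//; have := sq _ sp'.
  by have := transfer_sumsq ab (ltn_ord i); lia.
rewrite -mulr_suml -natr_sum => /eqP; rewrite -subr_eq0 -mulrBl mulf_eq0.
have := excess_gt pN sp nex => gt.
by rewrite subr_eq0 eqr_nat gtn_eqF//= => /eqP.
Qed.

Lemma casimir_expand (R : comNzRingType) N (U : 'M[R]_N) n (p : {ffun 'I_n -> nat}) :
  let T a := newton_mx U (p a) in
  \sum_a \sum_(b | b != a) (\tr (T a) * \tr (T b) + \tr (T a *m T b)) *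
     \prod_(c | (c != a) && (c != b)) sec U (p c) =
  \sum_a \sum_(b | b != a)
    ((p a * p b + minn (p a) (p b))%:R * \prod_c sec U (p c) +
     \sum_(i < minn (p a) (p b)) ((2 * i)%:R - (p a + p b)%:R) *
        \prod_c sec U (transfer p a b i c)).
Proof.
move=> T; apply: eq_bigr => a _; apply: eq_bigr => b ba.
rewrite !mxtrace_newton mxtrace_newtonM.
have ab : a != b by rewrite eq_sym.
rewrite addrA mulrDl; congr (_ + _).
  rewrite (bigD2 _ _ ab) /=.
  rewrite natrD natrM -[sec U (p a) *+ _]mulr_natr -[sec U (p b) *+ _]mulr_natr -[(_ * _) *+ _]mulr_natr.
  by ring.
rewrite mulr_suml; apply: eq_bigr => i _; rewrite (big_transfer _ _ _ _ ab) /=.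
by ring.
Qed.

(** * Alternants and elementary symmetric polynomials *)

Lemma card_ltset N m : (m <= N)%N -> #|[set i : 'I_N | (i < m)%N]| = m.
Proof.
move=> mN; rewrite -sum1_card (eq_bigl (fun i : 'I_N => i < m)%N) => [|l]; last by rewrite inE.
by rewrite -(big_ord_widen N (fun=> 1%N))// sum1_card card_ord.
Qed.

Lemma mem_downset N (S : {set 'I_N}) :
  (forall i j : 'I_N, (i <= j)%N -> j \in S -> i \in S) ->
  forall i : 'I_N, (i \in S) = (i < #|S|)%N.
Proof.
move=> down i; have dN : (#|S| <= N)%N by rewrite -[leqRHS]card_ord max_card.
suff E : S = [set i : 'I_N | (i < #|S|)%N] by rewrite [in LHS]E inE.
apply/eqP; rewrite eqEcard card_ltset// leqnn andbT; apply/subsetP => j jS; rewrite inE.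
rewrite -(card_ltset (ltn_ord j)); apply/subset_leq_card/subsetP => l.
by rewrite inE ltnS => ij; exact: down jS.
Qed.

Section Monomials.
Variables (R : comNzRingType) (N : nat).
Implicit Types (p q : mpoly N R) (f g : 'I_N -> nat).

Definition expo f : multinom N := Multinom (mktuple f).
Definition mono f : mpoly N R := mpolyX R (expo f).

Lemma expoE f i : expo f i = f i.
Proof. exact: mnmE. Qed.

Lemma eq_mono f g : f =1 g -> mono f = mono g.
Proof. by move=> fg; congr mpolyX; apply/mnmP => i; rewrite !expoE. Qed.

Lemma monoD f g : mono f * mono g = mono (fun i => f i + g i)%N.
Proof. by rewrite /mono -mpolyXD; congr mpolyX; apply/mnmP => i; rewrite mnmDE !expoE. Qed.

Lemma mcoeff_mono f g : mcoeff (expo g) (mono f) = [forall i, f i == g i]%:R.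
Proof.
rewrite mcoeffX; congr (_%:R); congr nat_of_bool; apply/eqP/forallP => [/mnmP fg i|fg].
  by have := fg i; rewrite !expoE => ->.
by apply/mnmP => i; rewrite !expoE; apply/eqP.
Qed.

(** The Euler operator x_i d/dx_i: a derivation that is diagonal on monomials. *)
Definition theta i p : mpoly N R := mpolyX R (mnm1 i) * mderiv i p.

Lemma theta_is_linear i : linear (theta i).
Proof. by move=> c p q; rewrite /theta linearP mulrDr scalerAr. Qed.

HB.instance Definition _ i :=
  GRing.isLinear.Build R (mpoly N R) (mpoly N R) _ (theta i) (theta_is_linear i).

Lemma thetaM i p q : theta i (p * q) = theta i p * q + p * theta i q.
Proof. by rewrite /theta mderivM; ring. Qed.

Lemma theta_mpolyX i (m : multinom N) : theta i (mpolyX R m) = (m i)%:R *: mpolyX R m.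
Proof.
rewrite /theta mderivX -scalerAr; case: (posnP (m i)) => [->|m0]; first by rewrite !scale0r.
rewrite -mpolyXD; congr (_ *: mpolyX _ _); apply/mnmP => j.
rewrite mnmDE mnmBE mnm1E; case: eqP => [<-|_]; last by rewrite add0n subn0.
by rewrite subnKC.
Qed.

Lemma theta_mono i f : theta i (mono f) = (f i)%:R *: mono f.
Proof. by rewrite theta_mpolyX expoE. Qed.

Lemma mcoeff_theta i p (m : multinom N) : mcoeff m (theta i p) = (m i)%:R * mcoeff m p.
Proof.
rewrite {1 2}(mpolyE p) !raddf_sum mulr_sumr /=; apply: eq_bigr => m' _.
rewrite linearZ /= theta_mpolyX !mcoeffZ mcoeffX.
by case: eqP => [->|_]; rewrite ?mulr0//; ring.
Qed.

Definition indic (S : {set 'I_N}) i : nat := i \in S.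

(** Sums over subsets, rather than coefficients of a product, are what the
    Pieri rule alt_elem acts on. *)
Definition elem (d : nat) : mpoly N R := \sum_(S : {set 'I_N} | #|S| == d) mono (indic S).

(** Elementary symmetric polynomials have degree at most one in each variable. *)
Lemma theta_elem_idem i d : theta i (theta i (elem d)) = theta i (elem d).
Proof.
rewrite !raddf_sum; apply: eq_bigr => S _ /=; rewrite theta_mono linearZ /= theta_mono.
by rewrite scalerA -natrM /indic; case: (i \in S).
Qed.

Lemma theta_elem i d :
  theta i (elem d) = \sum_(S : {set 'I_N} | (#|S| == d) && (i \in S)) mono (indic S).
Proof.
rewrite raddf_sum [RHS]big_mkcondr; apply: eq_bigr => S _ /=.
by rewrite theta_mono /indic; case: (i \in S); rewrite ?scale1r ?scale0r.
Qed.

Lemma theta_elemS i d :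
  theta i (elem d.+1) = mono (fun j => j == i) * (elem d - theta i (elem d)).
Proof.
have -> : elem d - theta i (elem d) =
    \sum_(S : {set 'I_N} | (#|S| == d) && (i \notin S)) mono (indic S).
  by rewrite theta_elem /elem (bigID (fun S : {set 'I_N} => i \in S)) /= [X in X - _]addrC addrK.
rewrite theta_elem mulr_sumr.
rewrite (reindex_onto (fun S => i |: S) (fun S => S :\ i)) /=; last first.
  by move=> S /andP[_ iS]; rewrite finset.setD1K.
have drop S : (i |: S) :\ i == S = (i \notin S).
  apply/eqP/idP => [<-|iS]; first by rewrite !inE eqxx.
  by rewrite setU1K.
apply: eq_big => [S|S]; rewrite setU11 andbT drop cardsU1.
  by case: (i \in S); rewrite ?andbF// add1n eqSS.
move=> /andP[_ iS]; rewrite monoD; apply: eq_mono => j; rewrite /indic !inE.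
by case: eqP => //= ->; rewrite (negPf iS).
Qed.

Lemma prod_1DX (s : {poly mpoly N R}) :
  \prod_(i < N) (s * (mono (fun j => j == i))%:P + 1) =
  \sum_(S : {set 'I_N}) s ^+ #|S| * (mono (indic S))%:P.
Proof.
rewrite bigA_distr; apply: eq_bigr => S _.
rewrite -big_mkcond big_split /= prodr_const; congr (_ * _).
rewrite -rmorph_prod /=; congr (_%:P).
rewrite (eq_bigr (fun i => mpolyX R (mnm1 i))); last first.
  move=> i _; congr mpolyX; apply/mnmP => j; rewrite expoE mnm1E eq_sym.
  by rewrite -val_eqE.
rewrite /mono mpolyXE_id big_mkcond; apply: eq_bigr => i _ /=.
by rewrite expoE /indic; case: (i \in S).
Qed.

(** For the generic diagonal matrix the secular coefficients are the
    elementary symmetric polynomials, so the trace formulas for arbitrary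
    matrices apply to the latter. *)
Definition genmx : 'M[mpoly N R]_N := diag_mx (\row_i mono (fun j => j == i)).

Lemma sec_genmx d : sec genmx d = elem d.
Proof.
rewrite /sec; have -> : 1%:M + 'X *: map_mx polyC genmx =
   diag_mx (\row_i ('X * (mono (fun j => j == i))%:P + 1)).
  apply/matrixP => i j; rewrite !mxE; case: eqP => [_|_] /=.
    by rewrite !mulr1n addrC.
  by rewrite !mulr0n polyC0 mulr0 addr0.
rewrite det_diag; under eq_bigr => i _ do rewrite mxE.
rewrite prod_1DX coef_sum [RHS]big_mkcond; apply: eq_bigr => S _ /=.
by rewrite coefMC coefXn eq_sym; case: eqP => _; rewrite ?mul1r ?mul0r.
Qed.

Lemma newton_genmx d i j : newton_mx genmx d i j = theta i (elem d) *+ (i == j).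
Proof.
elim: d i j => [|d IH] i j.
  rewrite mxE /elem (eq_bigl (fun S => S == finset.set0)); last by move=> S; rewrite cards_eq0.
  by rewrite big_pred1_eq theta_mono /indic inE scale0r mul0rn.
rewrite /= mxE [X in _ + X]mxE !mxE (bigD1 i)//= big1 ?addr0; last first.
  by move=> l li; rewrite !mxE eq_sym (negPf li) mulr0n mul0r.
rewrite !mxE eqxx mulr1n IH sec_genmx theta_elemS mulrBr [elem d * _]mulrC.
by case: (i == j); rewrite ?mulr1n ?mulr0n ?mul0r ?mulr0 ?subr0.
Qed.

Lemma mxtrace_newton_genmx d : \tr (newton_mx genmx d) = \sum_i theta i (elem d).
Proof. by apply: eq_bigr => i _; rewrite newton_genmx eqxx. Qed.

Lemma mxtrace_newtonM_genmx d e :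
  \tr (newton_mx genmx d *m newton_mx genmx e) =
  \sum_i theta i (elem d) * theta i (elem e).
Proof.
apply: eq_bigr => i _; rewrite mxE (bigD1 i)//= big1 ?addr0 => [|j ji].
  by rewrite !newton_genmx eqxx.
by rewrite newton_genmx eq_sym (negPf ji) mul0r.
Qed.

Definition alt f : mpoly N R :=
  \sum_(s : 'S_N) (-1) ^+ s *: mono (f \o s).

Lemma mono_exp f : mono f = \prod_i mono (fun j => j == i) ^+ f i.
Proof.
rewrite /mono mpolyXE_id; apply: eq_bigr => i _; rewrite expoE; congr (_ ^+ _).
by congr mpolyX; apply/mnmP => j; rewrite expoE mnm1E eq_sym -val_eqE.
Qed.

(** The alternant is a determinant with two equal rows. Exchanging the two
    exponents would only show that twice the alternant is 0. *)
Lemma alt_eq0 f i j : i != j -> f i = f j -> alt f = 0.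
Proof.
move=> ij fij; have <- : \det (\matrix_(j, i) mono (fun l => l == i) ^+ f j) = alt f.
  rewrite -det_tr /determinant /alt; apply: eq_bigr => s _.
  rewrite mono_exp -signr_odd -(signr_odd _ s); case: (odd _);
    rewrite ?expr0 ?expr1 ?mul1r ?scale1r ?mulN1r ?scaleN1r.
    by congr (- _); apply: eq_bigr => l _; rewrite !mxE.
  by apply: eq_bigr => l _; rewrite !mxE.
by rewrite (determinant_alternate ij)// => l; rewrite !mxE fij.
Qed.

Lemma sum_preim_perm (s : 'S_N) d (F : {set 'I_N} -> mpoly N R) :
  \sum_(S : {set 'I_N} | #|S| == d) F S =
  \sum_(S : {set 'I_N} | #|S| == d) F (s @^-1: S).
Proof.
rewrite (reindex_inj (h := fun S : {set 'I_N} => s @^-1: S)) /=.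
  apply: eq_bigl => S; by rewrite card_preimset//; apply: perm_inj.
move=> S T /setP ST; apply/setP => i.
by have := ST (s^-1%g i); rewrite !inE permKV.
Qed.

(** Pieri rule: since elem d is symmetric, its subsets may be transported by
    the permutation of each term of the alternant. *)
Lemma alt_elem f d :
  alt f * elem d = \sum_(S : {set 'I_N} | #|S| == d) alt (fun i => f i + indic S i)%N.
Proof.
rewrite /alt mulr_suml exchange_big /=; apply: eq_bigr => s _.
rewrite -scaler_sumr -scalerAl /elem (sum_preim_perm s) mulr_sumr; congr (_ *: _).
apply: eq_bigr => S _; rewrite monoD; apply: eq_mono => i.
by rewrite /indic /= inE.
Qed.

(** The same computation as for alt_elem, where the two Euler operators weigh
    the subset S by the sum of its exponents. *)
Lemma theta_alt_elem f d :
  \sum_i theta i (alt f) * theta i (elem d) =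
  \sum_(S : {set 'I_N} | #|S| == d)
     (\sum_(i in S) f i)%:R *: alt (fun i => f i + indic S i)%N.
Proof.
transitivity (\sum_(s : 'S_N) (-1) ^+ s *:
    \sum_(S : {set 'I_N} | #|S| == d)
       (\sum_(i in S) f i)%:R *: mono (fun i => f (s i) + indic S (s i))%N); last first.
  under [in RHS]eq_bigr => S _ do rewrite scaler_sumr.
  rewrite exchange_big; apply: eq_bigr => s _; rewrite scaler_sumr.
  by apply: eq_bigr => S _; rewrite scalerA mulrC -scalerA.
rewrite /alt.
under eq_bigr => i _ do rewrite raddf_sum mulr_suml.
rewrite exchange_big; apply: eq_bigr => s _ /=.
under eq_bigr => i _ do rewrite linearZ /= theta_mono -scalerAl.
rewrite -scaler_sumr; congr (_ *: _).
under [LHS]eq_bigr => i _ do rewrite /elem raddf_sum (sum_preim_perm s) mulr_sumr /=.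
rewrite exchange_big; apply: eq_bigr => S _ /=.
rewrite (eq_bigr (fun i => (f (s i) * indic S (s i))%:R *: mono (fun i => f (s i) + indic S (s i))%N)).
  rewrite -scaler_suml -natr_sum; congr (_%:R *: _).
  rewrite [RHS]big_mkcond [RHS](reindex_inj (@perm_inj _ s)) /=; apply: eq_bigr => i _.
  by rewrite /indic; case: (s i \in S); rewrite ?muln1 ?muln0.
move=> i _; rewrite theta_mono -scalerAl -scalerAr scalerA -natrM monoD.
congr (_%:R *: _); first by rewrite /indic inE.
by apply: eq_mono => j; rewrite /indic inE.
Qed.

Definition strict f := [forall i : 'I_N, forall j : 'I_N, (i < j)%N ==> (f j < f i)%N].

Lemma strictP f : reflect (forall i j : 'I_N, (i < j)%N -> (f j < f i)%N) (strict f).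
Proof.
apply: (iffP forallP) => [H i j|H i]; first by have /forallP/(_ j)/implyP := H i.
by apply/forallP => j; apply/implyP/H.
Qed.

(** Adding 0 or 1 to strictly decreasing exponents can at worst make two of
    them equal. *)
Lemma alt_indic_eq0 f (S : {set 'I_N}) : strict f ->
  ~~ strict (fun i => f i + indic S i)%N -> alt (fun i => f i + indic S i)%N = 0.
Proof.
move=> /strictP sf; rewrite negb_forall => /existsP[i]; rewrite negb_forall => /existsP[j].
rewrite negb_imply -leqNgt => /andP[ij le].
apply: (@alt_eq0 _ i j); first by rewrite -val_eqE /= ltn_eqF.
have := sf i j ij; move: le; rewrite /indic; case: (i \in S); case: (j \in S) => /=; lia.
Qed.

Definition staircase (i : 'I_N) : nat := (N - i.+1)%N.

Lemma strict_staircase : strict staircase.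
Proof. by apply/strictP => i j ij; rewrite /staircase; have := ltn_ord j; lia. Qed.

(** If adding the indicator of S keeps the staircase strict, then S is an
    initial segment, and the sum depends on its size only. *)
Lemma sum_staircase (S : {set 'I_N}) : strict (fun i => staircase i + indic S i)%N ->
  (2 * \sum_(i in S) staircase i = #|S| * (N.*2 - #|S|.+1))%N.
Proof.
move=> /strictP sf.
have down (i j : 'I_N) : (i <= j)%N -> j \in S -> i \in S.
  move: {2}(j - i)%N (erefl (j - i)%N) => m; elim: m i => [|m IH] i ji ij jS.
    by have -> : i = j by apply: val_inj; move: ij ji => /=; lia.
  have lt : (i.+1 < N)%N by have := ltn_ord j; lia.
  have iS : Ordinal lt \in S by apply: IH => //=; lia.
  have := sf i (Ordinal lt) (leqnn _); rewrite /staircase /indic iS /=.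
  by case: (i \in S) => //; lia.
have dN : (#|S| <= N)%N by rewrite -[leqRHS]card_ord max_card.
rewrite [X in (2 * X)%N](eq_bigl (fun i : 'I_N => i < #|S|)%N) => [|l]; last by rewrite (mem_downset down).
move: #|S| dN => d dN.
rewrite -(big_ord_widen N (fun i => N - i.+1)%N)//.
elim: d dN => [|d IH] dN; first by rewrite big_ord0.
rewrite big_ord_recr mulnDr IH ?(ltnW dN)//=.
have [e ->] : exists e, N = (d + e.+1)%N by exists (N - d).-1; lia.
have -> : (d + e.+1 - d.+1 = e)%N by lia.
have -> : ((d + e.+1).*2 - d.+1 = d + e.*2.+1)%N by lia.
have -> : ((d + e.+1).*2 - d.+2 = d + e.*2)%N by lia.
by rewrite -!muln2; nia.
Qed.

(** Only the initial segment of size d contributes, so that the mixed term of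
    the Laplacian acts on elem d by a scalar. *)
Lemma theta_staircase_elem d :
  (\sum_i theta i (alt staircase) * theta i (elem d)) *+ 2 =
  (d * (N.*2 - d.+1))%:R *: (alt staircase * elem d).
Proof.
rewrite theta_alt_elem alt_elem scaler_sumr -sumrMnl; apply: eq_bigr => S /eqP <-.
have [/sum_staircase <-|/(alt_indic_eq0 strict_staircase) ->] :=
  boolP (strict (fun i => staircase i + indic S i)%N).
  by rewrite scalerMnl natrM mulr_natl.
by rewrite !scaler0 mul0rn.
Qed.

(** On characters this is, up to conjugation by the Vandermonde determinant
    and a constant, the Laplacian of U(N). *)
Definition laplace p : mpoly N R := \sum_i theta i (theta i p).

Lemma mcoeff_laplace p (m : multinom N) :
  mcoeff m (laplace p) = (\sum_i m i ^ 2)%:R * mcoeff m p.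
Proof.
rewrite /laplace raddf_sum natr_sum mulr_suml; apply: eq_bigr => i _ /=.
by rewrite !mcoeff_theta mulrA -natrM mulnn.
Qed.

Lemma laplace_alt f : laplace (alt f) = (\sum_i f i ^ 2)%:R *: alt f.
Proof.
rewrite /laplace /alt scaler_sumr.
under [LHS]eq_bigr => i _ do rewrite !raddf_sum /=.
rewrite exchange_big; apply: eq_bigr => s _ /=.
rewrite [in RHS](reindex_inj (@perm_inj _ s)) natr_sum scaler_suml; apply: eq_bigr => i _.
rewrite linearZ /= theta_mono /= !linearZ /= theta_mono !scalerA -mulnn natrM.
by rewrite /= -mulrA.
Qed.

Lemma laplaceM p q :
  laplace (p * q) =
  laplace p * q + (\sum_i theta i p * theta i q) *+ 2 + p * laplace q.
Proof.
rewrite /laplace mulr_suml mulr_sumr -sumrMnl -!big_split; apply: eq_bigr => i _ /=.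
by rewrite thetaM raddfD /= !thetaM mulr2n; ring.
Qed.

Lemma laplace_prod_elem n (p : {ffun 'I_n -> nat}) :
  laplace (\prod_c elem (p c)) =
  (\sum_c p c)%:R *: \prod_c elem (p c) +
  \sum_a \sum_(b | b != a)
    \tr (newton_mx genmx (p a) *m newton_mx genmx (p b)) *
    \prod_(c | (c != a) && (c != b)) sec genmx (p c).
Proof.
rewrite /laplace.
under [LHS]eq_bigr => i _ do rewrite (derivation2_prod (thetaM i)).
rewrite big_split /= exchange_big; congr (_ + _).
  rewrite natr_sum scaler_suml; apply: eq_bigr => c _.
  rewrite -mulr_suml; under [X in X * _ = _]eq_bigr => i _ do rewrite theta_elem_idem.
  rewrite -mxtrace_newton_genmx mxtrace_newton sec_genmx [in RHS](bigD1 c)//=.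
  by rewrite scaler_nat mulrnAl.
rewrite exchange_big; apply: eq_bigr => a _ /=.
rewrite exchange_big; apply: eq_bigr => b _ /=.
rewrite mxtrace_newtonM_genmx mulr_suml; apply: eq_bigr => i _.
by congr (_ * _); apply: eq_bigr => c _; rewrite sec_genmx.
Qed.

Lemma theta_staircase_prod n (p : {ffun 'I_n -> nat}) :
  (\sum_i theta i (alt staircase) * theta i (\prod_c elem (p c))) *+ 2 =
  (\sum_c p c * (N.*2 - (p c).+1))%:R *: (alt staircase * \prod_c elem (p c)).
Proof.
under [X in X *+ _]eq_bigr => i _ do rewrite (derivation_prod (thetaM i)) mulr_sumr.
rewrite exchange_big natr_sum scaler_suml -sumrMnl; apply: eq_bigr => c _ /=.
under [X in X *+ _]eq_bigr => i _ do rewrite mulrA.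
rewrite -mulr_suml -mulrnAl theta_staircase_elem [in RHS](bigD1 c)//=.
by rewrite -scalerAl mulrA.
Qed.

(** The coefficient of the Schur polynomial of the rectangle (k^N) in the
    product of the elem (p c), a Kostka number for the content p. *)
Definition kostka k n (p : {ffun 'I_n -> nat}) : R :=
  mcoeff (expo (fun i => staircase i + k)%N) (alt staircase * \prod_c elem (p c)).

(** Apply the Laplacian to the product of the alternant and the elem (p c) and
    compare coefficients at the exponent in kostka: the alternant and the
    monomial are eigenvectors, the mixed term is scalar by
    theta_staircase_prod, and what remains is the sum of the traces of
    products, to be rewritten by casimir_expand. *)
Lemma kostka_rec k n (p : {ffun 'I_n -> nat}) :
  (\sum_c p c = k * N)%N -> (forall c, p c <= N)%N ->
  exchange_rec k N (@kostka k n) p.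
Proof.
move=> sp pN; rewrite /exchange_rec /kostka; set mu := expo _.
set f := \prod_c elem (p c).
have nat_coef x (q : mpoly N R) :
    mcoeff mu (alt staircase * (x%:R * q)) = x%:R * mcoeff mu (alt staircase * q).
  by rewrite !mulr_natl mulrnAr mcoeffMn.
have cas := casimir_expand genmx p; rewrite /= in cas.
have {cas} cas : \sum_a \sum_(b | b != a) ((p a * p b)%:R * f +
   \tr (newton_mx genmx (p a) *m newton_mx genmx (p b)) *
    \prod_(c | (c != a) && (c != b)) sec genmx (p c)) =
  \sum_a \sum_(b | b != a)
    ((p a * p b + minn (p a) (p b))%:R * f +
     \sum_(i < minn (p a) (p b)) ((2 * i)%:R - (p a + p b)%:R) *
        \prod_c elem (transfer p a b i c)).
  transitivity (\sum_a \sum_(b | b != a) (\tr (newton_mx genmx (p a)) * \tr (newton_mx genmx (p b))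
     + \tr (newton_mx genmx (p a) *m newton_mx genmx (p b))) *
     \prod_(c | (c != a) && (c != b)) sec genmx (p c)).
    apply: eq_bigr => a _; apply: eq_bigr => b ba; rewrite mulrDl; congr (_ + _).
    rewrite !mxtrace_newton !sec_genmx /f eq_sym in ba *; rewrite (bigD2 _ _ ba) /=.
    rewrite mulrA natrM -[elem (p a) *+ _]mulr_natr -[elem (p b) *+ _]mulr_natr.
    under [in RHS]eq_bigr => c _ do rewrite sec_genmx.
    by ring.
  rewrite cas; apply: eq_bigr => a _; apply: eq_bigr => b _; congr (_ * _ + _).
    by apply: eq_bigr => c _; rewrite sec_genmx.
  apply: eq_bigr => i _; congr (_ * _).
  by apply: eq_bigr => c _; rewrite sec_genmx.
transitivity (mcoeff mu (alt staircase * \sum_a \sum_(b | b != a)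
    ((p a * p b + minn (p a) (p b))%:R * f +
     \sum_(i < minn (p a) (p b)) ((2 * i)%:R - (p a + p b)%:R) *
        \prod_c elem (transfer p a b i c)))).
  rewrite mulr_sumr raddf_sum; apply: eq_bigr => a _ /=.
  rewrite mulr_sumr raddf_sum; apply: eq_bigr => b _ /=.
  rewrite mulrDr mcoeffD nat_coef; congr (_ + _).
  rewrite mulr_sumr raddf_sum; apply: eq_bigr => i _ /=.
  by rewrite !mulrBl mulrBr mcoeffB !nat_coef.
rewrite -cas {cas}.
under eq_bigr => a _ do rewrite big_split -mulr_suml -natr_sum /=.
rewrite big_split -mulr_suml -natr_sum /=; set X := (\sum_a \sum_(b | _) _ * _)%N.
have := congr1 (mcoeff mu) (laplaceM (alt staircase) f).
rewrite mcoeff_laplace laplace_alt theta_staircase_prod laplace_prod_elem -/f sp.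
rewrite !mulrDr !mcoeffD nat_coef -scalerAl -scalerAr !mcoeffZ.
move: (mcoeff mu (_ * \sum_a _)) (mcoeff mu _) => c1 M.
set w := (\sum_c _ * (_ - _))%N; set s1 := (\sum_i mu i ^ 2)%N; set s2 := (\sum_i staircase i ^ 2)%N.
(* s1 and s2 are the eigenvalues of the monomial and of the alternant, w that
   of the mixed term, k * N counts the squares of single Euler operators *)
have : (X + s1 = k * k.-1 * (N * N.+1) + s2 + w + k * N)%N.
  have H1 : (X + \sum_c p c ^ 2 = (k * N) ^ 2)%N.
    rewrite -mulnn -[in RHS]sp big_distrl -big_split; apply: eq_bigr => a _ /=.
    by rewrite big_distrr [in RHS](bigD1 a)//= addnC mulnn.
  have H2 : (w + k * N + \sum_c p c ^ 2 = 2 * N * (k * N))%N.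
    rewrite -sp /w big_distrr -!big_split; apply: eq_bigr => c _ /=.
    by have := pN c; nia.
  have H3 : (s1 = s2 + k * (2 * \sum_i staircase i) + N * k ^ 2)%N.
    rewrite mulnA [(k * 2)%N]mulnC big_distrr /= /s1 /s2 -[in (N * _)%N](card_ord N) -sum_nat_const -!big_split.
    by apply: eq_bigr => i _ /=; rewrite expoE; nia.
  have H4 : (2 * \sum_i staircase i = N * N.-1)%N.
    rewrite (eq_bigl (fun i => i \in finset.setT)) => [|i]; last by rewrite inE.
    rewrite sum_staircase; first rewrite cardsT card_ord.
      by congr (_ * _)%N; lia.
    by apply/strictP => i j ij; rewrite /indic !inE /staircase; have := ltn_ord j; lia.
  rewrite H4 in H3; case: (k) H1 H2 H3 => [|k'] /=; case: (N) => [|N'] /=; nia.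
move=> /(congr1 (GRing.natmul (1 : R))); rewrite !natrD => E1 E2.
apply: (addIr (s1%:R * M)); rewrite {2}E2.
transitivity ((X%:R + s1%:R) * M + c1); first by ring.
by rewrite E1; ring.
Qed.

End Monomials.

(** * Pieri expansion into chains of partitions *)

Lemma incr_perm_ge N (s : 'S_N) :
  (forall i j : 'I_N, (i < j)%N -> (s i < s j)%N) -> forall i : 'I_N, (i <= s i)%N.
Proof.
move=> inc [m]; elim: m => [|m IH] mN //=.
have mN' := ltnW mN; apply: leq_ltn_trans (IH mN') _.
by apply: inc.
Qed.

Lemma incr_perm_id N (s : 'S_N) :
  (forall i j : 'I_N, (i < j)%N -> (s i < s j)%N) -> s = 1%g.
Proof.
move=> inc; have incV (i j : 'I_N) : (i < j)%N -> (s^-1%g i < s^-1%g j)%N.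
  move=> ij; rewrite ltnNge leq_eqVlt; apply/negP => /orP[/eqP/val_inj/perm_inj E|/inc].
    by rewrite E ltnn in ij.
  by rewrite !permKV ltnNge (ltnW ij).
apply/permP => i; rewrite perm1; apply/val_inj/eqP; rewrite eqn_leq incr_perm_ge// andbT.
by have := incr_perm_ge incV (s i); rewrite permK.
Qed.

Section Chains.
Variables (R : comNzRingType) (N : nat).
Implicit Types (f g : 'I_N -> nat) (S : {set 'I_N}).
Local Notation altR := (@alt R N).
Local Notation elemR := (@elem R N).

Lemma eq_alt f g : f =1 g -> altR f = altR g.
Proof. by move=> fg; apply: eq_bigr => s _; congr (_ *: _); apply: eq_mono => i /=. Qed.

(** A permutation relating two strictly decreasing sequences is increasing,
    hence the identity, so only the leading monomial can occur. *)
Lemma mcoeff_alt f g : strict f -> strict g ->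
  mcoeff (expo g) (altR f) = [forall i, f i == g i]%:R.
Proof.
move=> /strictP sf /strictP sg; rewrite raddf_sum (bigD1 1%g)//= big1 => [|s s1].
  rewrite addr0 odd_perm1 expr0 scale1r mcoeff_mono.
  by congr (_%:R); congr nat_of_bool; apply: eq_forallb => i; rewrite /= perm1.
rewrite mcoeffZ mcoeff_mono; case: forallP => [E|_]; last by rewrite mulr0.
case/eqP: s1; apply: incr_perm_id => i j ij.
have := sg i j ij; rewrite -!(eqP (E _)) /= => lt; rewrite ltnNge leq_eqVlt.
apply/negP => /orP[/eqP/val_inj E'|/sf]; first by rewrite E' ltnn in lt.
by move=> /ltnW; rewrite leqNgt lt.
Qed.

Lemma alt_mono_const f k : altR f * mono R (fun=> k) = altR (fun i => f i + k)%N.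
Proof.
rewrite /alt mulr_suml; apply: eq_bigr => s _.
by rewrite -scalerAl monoD.
Qed.

Lemma mono0 : mono R (fun=> 0%N) = 1 :> mpoly N R.
Proof. by rewrite /mono -mpolyX0; congr mpolyX; apply/mnmP => i; rewrite expoE mnm0E. Qed.

Lemma elem0 : elemR 0 = mono R (fun=> 0%N).
Proof.
rewrite /elem (eq_bigl (pred1 finset.set0)) => [|S]; last by rewrite cards_eq0.
by rewrite big_pred1_eq; apply: eq_mono => i; rewrite /indic inE.
Qed.

Lemma elemN : elemR N = mono R (fun=> 1%N).
Proof.
rewrite /elem (eq_bigl (pred1 finset.setT)) => [|S].
  by rewrite big_pred1_eq; apply: eq_mono => i; rewrite /indic inE.
by rewrite /= [RHS]eqEcard finset.subsetT cardsT card_ord eqn_leq [in LHS](leq_trans (max_card _)) ?card_ord.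
Qed.

Lemma elem_big d : (N < d)%N -> elemR d = 0.
Proof.
move=> Nd; rewrite /elem big1// => S /eqP cS.
by have := max_card (mem S); rewrite cS card_ord leqNgt Nd.
Qed.

(** After t steps the i-th part of the partition is the number of strips, among
    the first t, that meet the i-th row. *)
Definition level (l : seq {set 'I_N}) t (i : 'I_N) : nat := count (fun S => i \in S) (take t l).

Definition chain f (l : seq {set 'I_N}) := [forall t : 'I_(size l).+1, strict (fun i => f i + level l t i)%N].

Lemma chain_cons f S (l : seq {set 'I_N}) :
  strict f -> chain f (S :: l) = chain (fun i => f i + indic S i)%N l.
Proof.
move=> sf; have E (t : nat) : strict (fun i => f i + level (S :: l) t.+1 i)%N =
    strict (fun i => f i + indic S i + level l t i)%N.
  by rewrite /strict; under eq_forallb => i do under eq_forallb => j do rewrite /level /= !addnA.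
apply/forallP/forallP => H t.
  by have := H (lift ord0 t); rewrite /= E.
case: t => -[|t] /= tl.
  move/strictP in sf; apply/strictP => i j ij; rewrite /level /= !addn0; exact: sf.
by rewrite E; exact: (H (Ordinal (tl : (t < (size l).+1)%N))).
Qed.

(** Non-strict exponents are discarded as soon as they appear, because their
    alternant is already 0; only the chains remain. *)
Lemma alt_prod_elem n (p : seq nat) f : size p = n -> strict f ->
  altR f * \prod_(d <- p) elemR d =
  \sum_(l : n.-tuple {set 'I_N} |
     (map (fun S => #|S|) l == p) && chain f l)
    altR (fun i => f i + level l n i)%N.
Proof.
move=> <- {n}; elim: p f => [|d p IH] f sf.
  rewrite big_nil mulr1 (big_pred1 [tuple]).
    by apply: eq_alt => i; rewrite /level take0 addn0.
  move=> l; rewrite tuple0 eqxx /=; apply/forallP => t; apply/strictP => i j ij.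
  by rewrite /level !addn0; move/strictP: sf; apply.
rewrite big_cons mulrA alt_elem mulr_suml.
rewrite (reindex (fun sl : {set 'I_N} * (size p).-tuple {set 'I_N} => [tuple of sl.1 :: sl.2])) /=; last first.
  exists (fun l : (size p).+1.-tuple {set 'I_N} => (thead l, [tuple of behead l])) => [[S l] _|l _] /=.
    by congr (_, _); apply: val_inj.
  by case/tupleP: l => x m; apply: val_inj; rewrite /= theadE.
rewrite (eq_bigl (fun sl : {set 'I_N} * (size p).-tuple {set 'I_N} =>
   (#|sl.1| == d) && ((map (fun S => #|S|) sl.2 == p) && chain (fun i => f i + indic sl.1 i)%N sl.2))); last first.
  by move=> [S l] /=; rewrite chain_cons// eqseq_cons andbA.
rewrite -(pair_big_dep (fun S : {set 'I_N} => #|S| == d)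
   (fun S (l : (size p).-tuple {set 'I_N}) =>
      (map (fun S => #|S|) l == p) && chain (fun i => f i + indic S i)%N l)
   (fun S l => altR (fun i => f i + level (S :: l) (size p).+1 i)%N)) /=.
apply: eq_bigr => S _.
have [sS|nS] := boolP (strict (fun i => f i + indic S i)%N).
  rewrite IH//; apply: eq_bigr => l _; apply: eq_alt => i.
  by rewrite /level /= addnA.
rewrite alt_indic_eq0// mul0r big1// => l /andP[_ /forallP/(_ ord0)/strictP H].
case/negP: nS; apply/strictP => i j ij.
by have := H i j ij; rewrite /level take0 /= !addn0.
Qed.

Lemma strict_shift f k : strict f -> strict (fun i => f i + k)%N.
Proof. by move=> /strictP sf; apply/strictP => i j ij; rewrite ltn_add2r sf. Qed.

Lemma chain_strict f l : chain f l -> strict (fun i => f i + level l (size l) i)%N.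
Proof. by move=> /forallP/(_ ord_max). Qed.

Lemma kostka_chain k n (p : {ffun 'I_n -> nat}) :
  kostka R N k p =
  #|[set l : n.-tuple {set 'I_N} |
     [&& [forall c, #|tnth l c| == p c], chain (@staircase N) l & [forall i, level l n i == k]]]|%:R.
Proof.
rewrite /kostka.
have -> : \prod_c elemR (p c) = \prod_(d <- codom p) elemR d by rewrite big_map big_enum.
rewrite (@alt_prod_elem n); last first.
- exact: strict_staircase.
- by rewrite size_codom card_ord.
rewrite raddf_sum -sum1_card natr_sum big_mkcond [RHS]big_mkcond /=.
apply: eq_bigr => l _; rewrite inE.
have -> : (map (fun S => #|S|) l == codom p) = [forall c, #|tnth l c| == p c].
  have -> : map (fun S => #|S|) l = codom (fun c => #|tnth l c|).
    by rewrite -[in LHS](map_tnth_enum l) -map_comp.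
  apply/eqP/forallP => [/eq_in_map E c|E]; first by rewrite E ?mem_enum.
  by apply: eq_map => c; apply/eqP.
case: forallP => //= _; case: (boolP (chain _ _)) => //= ch.
rewrite mcoeff_alt; last exact/strict_shift/strict_staircase.
  rewrite (eq_forallb (fun i => eqn_add2l _ _ _)).
  by case: [forall _, _].
by have := chain_strict ch; rewrite size_tuple.
Qed.

(** Only elem 0 = 1 and elem N = x_1 ... x_N occur, the latter k times. *)
Lemma kostka_extreme k n (p : {ffun 'I_n -> nat}) : (0 < N)%N ->
  (\sum_c p c = k * N)%N -> (forall c, p c = 0 \/ p c = N)%N -> kostka R N k p = 1.
Proof.
move=> N0 sp pe; rewrite /kostka.
have -> : \prod_c elemR (p c) = mono R (fun=> k).
  have -> : k = (\sum_c (p c == N))%N.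
    apply/eqP; rewrite -(eqn_pmul2r N0) -sp big_distrl; apply/eqP/eq_bigr => c _ /=.
    by case: (pe c) => ->; rewrite ?eqxx ?mul1n// eq_sym (gtn_eqF N0).
  elim: (index_enum _) => [|c r IH]; first by rewrite !big_nil -mono0.
  rewrite !big_cons {}IH; case: (pe c) => ->.
    by rewrite elem0 monoD; apply: eq_mono => i; rewrite eq_sym (gtn_eqF N0).
  by rewrite elemN monoD eqxx.
rewrite alt_mono_const mcoeff_alt; try exact/strict_shift/strict_staircase.
by rewrite (_ : [forall i, _])//; apply/forallP => i.
Qed.

Lemma kostka_big k n (p : {ffun 'I_n -> nat}) : (exists c, N < p c)%N -> kostka R N k p = 0.
Proof.
by move=> [c /elem_big pc]; rewrite /kostka (bigD1 c)//= pc mul0r mulr0 raddf0.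
Qed.

End Chains.

(** * Chains of partitions as monotone matrices *)

(** Consecutive steps of the staircase have height 1, so strictness leaves
    exactly the weakly decreasing sequences. *)
Lemma strict_staircaseD N (h : 'I_N -> nat) :
  reflect (forall i j : 'I_N, (i <= j)%N -> (h j <= h i)%N)
          (strict (fun i => staircase i + h i)%N).
Proof.
apply: (iffP (strictP _)) => [sh i j|mono i j ij]; last first.
  by have := mono i j (ltnW ij); rewrite /staircase; have := ltn_ord j; lia.
move: {2}(j - i)%N (erefl (j - i)%N) => m; elim: m i => [|m IH] i ji ij.
  by have -> : i = j by apply: val_inj; move: ij ji => /=; lia.
have lt : (i.+1 < N)%N by have := ltn_ord j; lia.
have := IH (Ordinal lt); have := sh i (Ordinal lt) (leqnn _); rewrite /staircase /=.
by move: ji ij; lia.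
Qed.

Section Levels.
Variables (N : nat) (l : seq {set 'I_N}).
Implicit Types (t : nat) (a : 'I_N).

Lemma level0 a : level l 0 a = 0%N.
Proof. by rewrite /level take0. Qed.

Lemma levelS t a : level l t.+1 a = (level l t a + (a \in nth finset.set0 l t))%N.
Proof.
rewrite /level; case: (ltnP t (size l)) => tl.
  by rewrite (take_nth finset.set0)// -cats1 count_cat /= addn0.
by rewrite nth_default// inE addn0 !take_oversize// ltnW.
Qed.

Lemma level_le t a : (level l t a <= t)%N.
Proof. by elim: t => [|t IH]; rewrite ?level0// levelS; case: (_ \in _); lia. Qed.

Lemma leq_level s t a : (s <= t)%N -> (level l s a <= level l t a)%N.
Proof.
move=> st; rewrite -(subnKC st); elim: (t - s)%N => [|d IH]; first by rewrite addn0.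
by rewrite addnS levelS (leq_trans IH)// leq_addr.
Qed.

Lemma level_slope s t a : (s <= t)%N -> (level l t a <= level l s a + (t - s))%N.
Proof.
move=> st; rewrite -[in leqLHS](subnKC st); elim: (t - s)%N => [|d IH]; first by rewrite !addn0.
by rewrite addnS levelS; case: (_ \in _); lia.
Qed.

Lemma sum_level t : (\sum_a level l t a = \sum_(c < t) #|nth finset.set0 l c|)%N.
Proof.
elim: t => [|t IH]; first by rewrite big_ord0 big1// => a _; rewrite level0.
rewrite big_ord_recr /= -IH -sum1_card [X in (_ + X)%N]big_mkcond -big_split; apply: eq_bigr => a _ /=.
by rewrite levelS; case: (_ \in _).
Qed.

End Levels.

Section Box.
Variables (K N : nat).
Local Notation k := K.+1.
Implicit Types (l : (k + k).-tuple {set 'I_N}) (x : 'M[int]_k).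

Definition full_chain l :=
  chain (@staircase N) l && [forall i, level l (k + k) i == k].

(** Row a of the chain traces a lattice path: at time t it has risen level l t a
    times. The entry (i, j) counts the paths with at least k - j rises among
    the first (K - i) + (k - j) steps, those passing above one cell of the
    square. Entries with the same i + j thus form the conjugate of one partition
    of the chain, and the antidiagonal belongs to time k. *)
Definition box l : 'M[int]_k :=
  \matrix_(i, j) (#|[set a | (k - j <= level l ((K - i) + (k - j)) a)%N]|)%:Z.

Definition box_like x :=
  [/\ forall i j, 0 <= x i j <= N%:Z,
      forall i j j' : 'I_k, j' = j.+1 :> nat -> x i j <= x i j' &
      forall i i' j : 'I_k, i' = i.+1 :> nat -> x i' j <= x i j].

Lemma full_chainP l :
  reflect ((forall t, (t <= k + k)%N -> forall a b : 'I_N, (a <= b)%N -> (level l t b <= level l t a)%N)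
           /\ forall a, level l (k + k) a = k) (full_chain l).
Proof.
apply: (iffP andP) => [[/forallP ch /forallP tot]|[dec tot]]; split.
- move=> t tk; have tl : (t < (size l).+1)%N by rewrite size_tuple ltnS.
  by have /strict_staircaseD := ch (Ordinal tl).
- by move=> a; apply/eqP.
- apply/forallP => t; apply/strict_staircaseD; apply: dec.
  by rewrite -[X in (_ <= X)%N](size_tuple l) -ltnS ltn_ord.
- by apply/forallP => a; apply/eqP.
Qed.

Lemma box_likeP l : full_chain l -> box_like (box l).
Proof.
move=> _; split=> [i j|i j j' jj'|i i' j ii']; rewrite !mxE.
- by rewrite lez_nat -[X in (_ <= X)%N](card_ord N) max_card.
- rewrite lez_nat; apply/subset_leq_card/subsetP => a; rewrite !inE jj'.
  have jk : (j.+1 < k)%N by rewrite -jj'.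
  have -> : (K - i + (k - j) = (K - i + (k - j.+1)).+1)%N by lia.
  by rewrite levelS; case: (_ \in _); lia.
- rewrite lez_nat; apply/subset_leq_card/subsetP => a; rewrite !inE ii'.
  move=> /leq_trans; apply; apply: leq_level; lia.
Qed.

(** On the antidiagonal the time is k, and summing over the thresholds counts
    every rise of every path. *)
Lemma box_diag l : full_chain l ->
  \sum_i box l i (rev_ord i) = (\sum_(c < k) #|nth finset.set0 l c|)%N%:Z.
Proof.
move=> /full_chainP[_ tot].
have tot' a : (level l k a <= k)%N by rewrite -[leqRHS](tot a) leq_level// leq_addr.
rewrite -sum_level.
have -> : (\sum_a level l k a = \sum_(j < k) #|[set a | (j.+1 <= level l k a)%N]|)%N.
  under [RHS]eq_bigr => j _ do rewrite -sum1_card big_mkcond.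
  rewrite exchange_big; apply: eq_bigr => a _ /=.
  rewrite -[LHS](card_ltset (tot' a)) -sum1_card big_mkcond.
  by apply: eq_bigr => j _; rewrite !inE.
rewrite -natz natr_sum; apply: eq_bigr => i _; rewrite mxE natz /=.
congr (Posz #|pred_of_set _|); apply/setP => a; rewrite !inE.
have ik := ltn_ord i.
have -> : (k - (k - i.+1) = i.+1)%N by lia.
by have -> : (K - i + i.+1 = k)%N by lia.
Qed.

(** The j-th part of the conjugate partition at time t, read in the matrix. The
    row index may leave the matrix: a path cannot have risen j times before
    time j, and must have done so after j + k steps. *)
Definition wall x t j : nat :=
  if (t < j)%N then 0%N
  else if (t - j < k)%N then `|x (inord (K - (t - j))) (inord (k - j))|%N else N.

(** The rows with at least j rises form an initial segment, so a belongs to it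
    exactly when a is smaller than its cardinal. The boundary values of wall
    account for the times outside the matrix. *)
Lemma level_wall l t j (a : 'I_N) : full_chain l -> (0 < j <= k)%N -> (t <= k + k)%N ->
  (j <= level l t a)%N = (a < wall (box l) t j)%N.
Proof.
move=> /full_chainP[dec tot] /andP[j0 jk] tk; rewrite /wall.
case: (ltnP t j) => tj.
  by rewrite /= ltn0; apply/negbTE; rewrite -ltnNge (leq_ltn_trans (level_le _ _ _)).
case: (ltnP (t - j) k) => tjk; last first.
  rewrite ltn_ord; have := level_slope l a tk; rewrite tot; lia.
rewrite mxE absz_nat !inordK; [|lia|lia].
have -> : (k - (k - j) = j)%N by lia.
have -> : (K - (K - (t - j)) + j = t)%N by lia.
rewrite -(mem_downset (S := [set a | (j <= level l t a)%N])) ?inE// => b c bc.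
by rewrite !inE => /leq_trans; apply; apply: dec.
Qed.

(** By level_wall the matrix determines all levels, and a strip is the set of
    rows at which the level rises. *)
Lemma box_inj l l' : full_chain l -> full_chain l' -> box l = box l' -> l = l'.
Proof.
move=> fl fl' E.
have lev t a : (t <= k + k)%N -> level l t a = level l' t a.
  move=> tk; apply/eqP; rewrite eqn_leq.
  have aux l1 l2 : full_chain l1 -> full_chain l2 -> box l1 = box l2 -> (level l1 t a <= level l2 t a)%N.
    move=> f1 f2 E12; case: (posnP (level l1 t a)) => [->//|p0].
    have pk : (level l1 t a <= k)%N.
      by have /full_chainP[_ /(_ a) tot] := f1; rewrite -[leqRHS]tot leq_level.
    by rewrite level_wall ?p0//= -E12 -level_wall ?p0.
  by rewrite !aux.
apply: eq_from_tnth => c; apply/setP => a.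
have ck := ltn_ord c.
have := lev c.+1 a ck; rewrite !levelS lev ?(ltnW ck)// => /addnI.
by rewrite -!tnth_nth; do 2!case: (_ \in _).
Qed.

Section Surj.
Variable x : 'M[int]_k.
Hypothesis bx : box_like x.

Lemma wall_leN t j : (wall x t j <= N)%N.
Proof.
rewrite /wall; case: ifP => // _; case: ifP => // _.
have [/(_ (inord (K - (t - j))) (inord (k - j))) + _ _] := bx.
by lia.
Qed.

Lemma wall_col t j : (0 < j <= k)%N -> (wall x t j <= wall x t.+1 j)%N.
Proof.
move=> jk; case: (ltnP t j) => tj; first by rewrite /wall tj.
case: (ltnP (t.+1 - j) k) => tjk; last first.
  have -> : wall x t.+1 j = N by rewrite /wall ltnNge (leqW tj) /= ltnNge tjk.
  exact: wall_leN.
rewrite /wall !ltnNge tj (leqW tj) /= -!ltnNge tjk ifT; last by lia.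
have [bd _ col] := bx.
have := col (inord (K - (t.+1 - j))) (inord (K - (t - j))) (inord (k - j)).
rewrite !inordK; [|lia|lia] => /(_ _)/wrap[]; first by lia.
have := bd (inord (K - (t - j))) (inord (k - j)); have := bd (inord (K - (t.+1 - j))) (inord (k - j)); lia.
Qed.

(** Together with wall_col this is the interlacing of consecutive conjugate
    partitions. *)
Lemma wall_row t j : (0 < j < k)%N -> (wall x t.+1 j.+1 <= wall x t j)%N.
Proof.
move=> jk; rewrite /wall ltnS subSS; case: ifP => // _; case: ifP => // _.
have [bd row _] := bx.
have := row (inord (K - (t - j))) (inord (k - j.+1)) (inord (k - j)).
rewrite !inordK; [|lia|lia] => /(_ _)/wrap[]; first by lia.
have := bd (inord (K - (t - j))) (inord (k - j)); have := bd (inord (K - (t - j))) (inord (k - j.+1)); lia.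
Qed.

Definition height t (a : 'I_N) : nat := (\sum_(j < k) (a < wall x t j.+1))%N.

Definition unbox : (k + k).-tuple {set 'I_N} :=
  [tuple [set a | height t.+1 a != height t a] | t < k + k].

(** The walls decrease in j, so the thresholds met by a form an initial
    segment. *)
Lemma height_ge t j (a : 'I_N) : (0 < j <= k)%N -> (j <= height t a)%N = (a < wall x t j)%N.
Proof.
case: j => // j jk; pose S := [set i : 'I_k | (a < wall x t i.+1)%N].
have -> : height t a = #|S|.
  by rewrite -sum1_card big_mkcond; apply: eq_bigr => i _; rewrite inE; case: (_ < _)%N.
have -> : (j < #|S|)%N = (Ordinal (jk : (j < k)%N) \in S).
  rewrite mem_downset// => i1 i2; rewrite !inE => i12 /leq_trans; apply.
  rewrite -(subnKC i12); have := ltn_ord i2; rewrite -{1}(subnKC i12).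
  elim: (i2 - i1)%N => [|d IH]; first by rewrite addn0.
  rewrite addnS => lt; apply: leq_trans (IH _); last by lia.
  by apply: leq_trans (wall_col _ _) (wall_row _ _); lia.
by rewrite inE.
Qed.

(** Interlacing bounds the growth of the height in one step by 1, so the height
    counts the times at which it changes. *)
Lemma level_unbox t a : (t <= k + k)%N -> level unbox t a = height t a.
Proof.
elim: t => [|t IH] tk.
  by rewrite level0 /height big1// => j _; rewrite /wall.
rewrite levelS IH ?(ltnW tk)// -[t in nth _ _ t]/(val (Ordinal tk)) -tnth_nth tnth_mktuple inE /=.
have le1 : (height t a <= height t.+1 a)%N.
  apply: leq_sum => j _; have := @wall_col t j.+1 (ltn_ord j).
  by case: (ltnP a (wall x t j.+1)) => // /leq_trans H /H ->.
have le2 : (height t.+1 a <= (height t a).+1)%N.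
  rewrite /height big_ord_recl big_ord_recr /= -[leqRHS]add1n; apply: leq_add; first by case: (_ < _)%N.
  apply: leq_trans (leq_addr _ _); apply: leq_sum => j _; rewrite /bump /= add1n.
  have := @wall_row t j.+1 (ltn_ord j).
  by case: (ltnP a (wall x t.+1 j.+2)) => // H /(leq_trans H) ->.
by case: eqP => [->|]; lia.
Qed.

Lemma full_unbox : full_chain unbox.
Proof.
apply/full_chainP; split=> [t tk a b ab|a].
  rewrite !level_unbox//; apply: leq_sum => j _.
  by case: (ltnP b _) => // /(leq_ltn_trans ab) ->.
rewrite level_unbox// /height (eq_bigr (fun=> 1%N)) ?sum1_card ?card_ord// => j _.
have jk := ltn_ord j.
rewrite /wall ifF; last by lia.
by rewrite ifF; [rewrite ltn_ord|lia].
Qed.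

Lemma box_unbox : box unbox = x.
Proof.
apply/matrixP => i j; rewrite mxE; have ik := ltn_ord i; have jk := ltn_ord j.
rewrite (_ : [set a | _] = [set a : 'I_N | (a < wall x (K - i + (k - j)) (k - j))%N]).
  rewrite card_ltset ?wall_leN// /wall ifF; last by lia.
  rewrite addnK ifT; last by lia.
  have [bd _ _] := bx.
  have -> : inord (K - (K - i)) = i by apply: val_inj; rewrite /= inordK; lia.
  have -> : inord (k - (k - j)) = j by apply: val_inj; rewrite /= inordK; lia.
  by have := bd i j; lia.
by apply/setP => a; rewrite !inE level_unbox ?height_ge//; lia.
Qed.

End Surj.
End Box.

(** * Unitary matrices: duality of secular coefficients, complex reflections *)

Lemma poly_eq_inj (F : fieldType) (f : nat -> F) (p q : {poly F}) :
  injective f -> (forall n, p.[f n] = q.[f n]) -> p = q.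
Proof.
move=> injf pq; apply/eqP; rewrite -subr_eq0; apply/negPn/negP => nz.
have := max_poly_roots nz (rs := map f (iota 0 (size (p - q)))).
rewrite size_map size_iota ltnn => H; suff : false by [].
apply: H; last by rewrite map_inj_uniq ?iota_uniq.
by apply/allP => x /mapP[n _ ->]; rewrite rootE hornerD hornerN pq subrr.
Qed.

(** Twice the coefficient of X^2 is the second derivative at 0, and the factors
    have none of their own. *)
Lemma coef2_prod_affine (R : comNzRingType) (I : finType) (a b : I -> R) :
  (\prod_i ((a i)%:P + (b i)%:P * 'X))`_2 *+ 2 =
  \sum_i \sum_(j | j != i) b i * b j * \prod_(l | (l != i) && (l != j)) a l.
Proof.
have d1 i : ((a i)%:P + (b i)%:P * 'X)^`() = (b i)%:P.
  by rewrite derivD derivM derivX !derivC mul0r mulr1 !add0r.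
have -> (q : {poly R}) : q`_2 *+ 2 = (q^`())^`()`_0 by rewrite !coef_deriv mulr1n.
rewrite (derivation2_prod (d := @deriv R) (@derivM R)) coefD !coef_sum /=.
rewrite [X in X + _]big1 ?add0r => [|i _]; last by rewrite d1 derivC mul0r coef0.
apply: eq_bigr => i _; rewrite coef_sum; apply: eq_bigr => j _.
rewrite !d1 -polyCM coefCM -horner_coef0 horner_prod; congr (_ * _).
by apply: eq_bigr => l _; rewrite hornerD hornerM !hornerC hornerX mulr0 addr0.
Qed.

Lemma coef2_affineX (R : comNzRingType) (s : R) k :
  ((1 + s%:P * 'X) ^+ k)`_2 *+ 2 = (k * k.-1)%:R * s ^+ 2.
Proof.
have := @coef2_prod_affine R 'I_k (fun=> 1) (fun=> s).
rewrite prodr_const card_ord => ->.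
rewrite (eq_bigr (fun=> (s ^+ 2) *+ k.-1)) => [|i _].
  by rewrite sumr_const card_ord -mulrnA mulr_natl mulnC.
rewrite (eq_bigr (fun=> s ^+ 2)) => [|j _]; last by rewrite big1// mulr1.
by rewrite sumr_const; congr (_ *+ _); have := cardC1 i; rewrite card_ord.
Qed.

Section Reversal.
Variables (F : numFieldType) (N : nat).
Implicit Type U : 'M[F]_N.

Lemma size_secular U : (size (\det (1%:M + 'X *: map_mx polyC U)) <= N.+1)%N.
Proof.
set A := 1%:M + _.
apply: (leq_trans (size_sum _ _ _)); apply/bigmax_leqP => s _.
rewrite -signr_odd; set sg : {poly F} := (-1) ^+ _.
have -> : sg = ((-1) ^+ odd (perm.odd_perm s))%:P.
  by rewrite /sg; case: (odd _); rewrite ?expr0// expr1 polyCN.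
rewrite mul_polyC (leq_trans (size_scale_leq _ _))//.
apply: leq_trans (size_poly_prod_leq _ _) _.
have le (i : 'I_N) : (size (A i (s i)) <= 2)%N.
  rewrite !mxE (leq_trans (size_polyD _ _))// geq_max; apply/andP; split.
    by case: (_ == _); rewrite ?size_poly1 ?size_poly0.
  by rewrite mulrC mul_polyC (leq_trans (size_scale_leq _ _))// size_polyX.
have : (\sum_(i < N) size (A i (s i)) <= \sum_(i < N) 2)%N.
  by apply: leq_sum => i _; exact: le.
rewrite sum_nat_const cardT size_enum_ord => H.
by rewrite leq_subLR addnS ltnS (leq_trans H)// muln2 addnn.
Qed.

Lemma sec_big U d : (N < d)%N -> sec U d = 0.
Proof. by move=> Nd; rewrite /sec nth_default// (leq_trans (size_secular U)). Qed.

Lemma horner_secular U x : (\det (1%:M + 'X *: map_mx polyC U)).[x] = \det (1%:M + x *: U).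
Proof.
rewrite -horner_evalE -det_map_mx; congr (\det _); apply/matrixP => i j.
by rewrite !mxE /= horner_evalE hornerD hornerM hornerX hornerC hornerMn hornerC.
Qed.

Lemma sec0 U : sec U 0 = 1.
Proof. by rewrite /sec -horner_coef0 horner_secular scale0r addr0 det1. Qed.

(** The two polynomials are reversals of each other: they agree at every x <> 0
    by homogeneity of the determinant. *)
Lemma det_shift_rev U :
  \det ('X%:M + map_mx polyC U) = \poly_(j < N.+1) sec U (N - j).
Proof.
apply: (@poly_eq_inj _ (fun n => n.+1%:R)) => [m n /eqP|n].
  by rewrite eqr_nat => /eqP[].
set x : F := _%:R; have x0 : x != 0 by rewrite pnatr_eq0.
rewrite -horner_evalE -det_map_mx.
have -> : map_mx (horner_eval x) ('X%:M + map_mx polyC U) = x *: (1%:M + x^-1 *: U).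
  apply/matrixP => i j; rewrite !mxE /= horner_evalE hornerD hornerMn hornerX hornerC.
  by rewrite mulrDr mulrA divff// mul1r mulr_natr.
rewrite detZ -horner_secular (horner_coef_wide _ (size_secular U)).
rewrite horner_poly mulr_sumr (reindex_inj rev_ord_inj) /=; apply: eq_bigr => j _.
have jN := ltn_ord j; rewrite subSS /sec mulrCA; congr (_ * _).
by rewrite exprVn -expfB_cond ?(negPf x0) ?subKn//; lia.
Qed.

Lemma sec_top U : sec U N = \det U.
Proof.
have := congr1 (horner_eval 0) (det_shift_rev U).
rewrite -[X in X = _]det_map_mx horner_evalE horner_coef0 coef_poly subn0 /= => <-.
congr (\det _); apply/matrixP => i j.
by rewrite !mxE /= horner_evalE hornerD hornerMn hornerX hornerC mul0rn add0r.
Qed.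

End Reversal.

Section Unitary.
Local Open Scope sesquilinear_scope.
Variables (C : numClosedFieldType) (N : nat).
Implicit Types (U A B : 'M[C]_N) (v : 'cV[C]_N).

Lemma det_unitary_conj U : U \is unitarymx -> \det U * (\det U)^* = 1.
Proof.
move=> /unitarymxP/(congr1 determinant); rewrite det_mulmx det1 => <-.
by rewrite det_map_mx det_tr.
Qed.

(** Multiplying 1 + x U^* by U turns it into x + U, whose determinant has the
    secular coefficients of U in reverse order. *)
Lemma conj_sec U d : U \is unitarymx -> (d <= N)%N ->
  (sec U d)^* = (\det U)^* * sec U (N - d).
Proof.
move=> uU dN; have := det_unitary_conj uU => dU.
have E1 : (sec U d)^* = sec (U ^t*) d.
  rewrite /sec -coef_map -det_map_mx -det_tr; congr (polyseq (\det _))`_d; apply/matrixP => i j.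
  rewrite !mxE rmorphD rmorphM /= map_polyX map_polyC /= eq_sym.
  by case: (_ == _); rewrite ?rmorph1 ?rmorph0.
suff E2 : \det U * sec (U ^t*) d = sec U (N - d).
  by rewrite -E2 mulrA [_^* * _]mulrC dU mul1r.
have := congr1 (coefp d) (det_shift_rev U); rewrite /= coef_poly ltnS dN => <-.
rewrite /sec -coefCM -[(\det U)%:P](det_map_mx polyC) -det_mulmx mulmxDr mulmx1 -scalemxAr.
have /unitarymxP UU := uU.
by rewrite -map_mxM UU map_mx1 scalemx1 addrC.
Qed.

Definition qform A v : C := (v ^t* *m A *m v) 0 0.
Definition sqnorm v : C := qform 1%:M v.

Lemma sqnormE v : sqnorm v = \sum_i `|v i 0| ^+ 2.
Proof.
rewrite /sqnorm /qform mulmx1 mxE; apply: eq_bigr => i _.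
by rewrite !mxE normCK mulrC.
Qed.

Lemma sqnorm_eq0 v : (sqnorm v == 0) = (v == 0).
Proof.
rewrite sqnormE; apply/idP/eqP => [|->]; last by rewrite big1// => i _; rewrite mxE normr0 expr0n.
rewrite psumr_eq0 => [/allP H|i _]; last by rewrite exprn_ge0.
apply/matrixP => i j; rewrite ord1 mxE; apply/eqP.
by have := H i (mem_index_enum i); rewrite expf_eq0 /= normr_eq0.
Qed.

Lemma conj_sqnorm v : (sqnorm v)^* = sqnorm v.
Proof. by rewrite sqnormE rmorph_sum; apply: eq_bigr => i _; rewrite rmorphXn /= conj_normC. Qed.

(** The unitary matrix that multiplies v by z and fixes its orthogonal
    complement. *)
Definition reflection v (z : C) : 'M[C]_N :=
  1%:M + ((z - 1) / sqnorm v) *: (v *m v ^t*).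

Lemma det_reflection v z : v != 0 -> \det (reflection v z) = z.
Proof.
move=> v0; rewrite /reflection scalemxAl det_rank1 ?det1 ?oner_eq0//.
rewrite adj1 -scalemxAr mxE -/(sqnorm v) divfK ?sqnorm_eq0//; ring.
Qed.

Lemma reflection_unitary v z : v != 0 -> z * z^* = 1 -> reflection v z \is unitarymx.
Proof.
move=> v0 zz; have s0 : sqnorm v != 0 by rewrite sqnorm_eq0.
apply/unitarymxP; rewrite /reflection.
(* unitarity of 1 + t v v^* amounts to this relation *)
set t := _ / _; have tt : t + t^* + t * t^* * sqnorm v = 0.
  apply: (mulIf s0); rewrite mul0r /t rmorphM fmorphV rmorphB rmorph1 /= conj_sqnorm.
  transitivity (z * z^* - 1); first by field.
  by rewrite zz subrr.
have -> : (1%:M + t *: (v *m v ^t*)) ^t* = 1%:M + t^* *: (v *m v ^t*).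
  apply/matrixP => i j; rewrite !mxE rmorphD rmorphM /= rmorph_sum /= eq_sym.
  case: (_ == _); rewrite ?rmorph1 ?rmorph0; congr (_ + _ * _); apply: eq_bigr => l _;
  by rewrite !mxE rmorphM /= conjCK mulrC.
rewrite mulmxDl mul1mx mulmxDr mulmx1 -addrA; apply/eqP; rewrite -subr_eq0 addrAC subrr add0r.
rewrite -scalemxAl -scalemxAr scalerA.
have -> : v *m v ^t* *m (v *m v ^t*) = sqnorm v *: (v *m v ^t*).
  rewrite mulmxA -[v *m _ *m v]mulmxA [v ^t* *m v]mx11_scalar mul_mx_scalar -scalemxAl.
  by rewrite /sqnorm /qform mulmx1.
rewrite scalerA -!scalerDl [X in X *: _](_ : _ = t + t^* + t * t^* * sqnorm v); last by ring.
by rewrite tt scale0r.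
Qed.

Lemma sec_reflection v z U d :
  sec (reflection v z *m U) d =
  sec U d + ((z - 1) / sqnorm v) * qform (newton_mx U d) v.
Proof. by rewrite sec_rank1. Qed.

(** The Cayley transform of the natural numbers supplies infinitely many points
    of the unit circle, enough to identify polynomials. *)
Definition unit_point n : C := (1 + 'i * n%:R) / (1 - 'i * n%:R).

Lemma unit_point_denom (n : nat) : 1 - 'i * n%:R != 0 :> C.
Proof.
apply/eqP => /(congr1 (fun x => x * (1 + 'i * n%:R))); rewrite mul0r.
have -> : (1 - 'i * n%:R) * (1 + 'i * n%:R) = 1 - 'i ^+ 2 * n%:R ^+ 2 :> C by ring.
rewrite sqrCi mulN1r opprK => /eqP; apply/negP.
by rewrite gt_eqF// ltr_pwDl// exprn_ge0.
Qed.

Lemma unit_pointK n : unit_point n * (unit_point n)^* = 1.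
Proof.
have d1 := unit_point_denom n.
have d2 : 1 + 'i * n%:R != 0 :> C.
  by rewrite -conjC_eq0 rmorphD rmorphM rmorph1 /= conjCi rmorph_nat mulNr.
rewrite /unit_point rmorphM fmorphV rmorphD rmorphB rmorphM rmorph1 /= conjCi rmorph_nat mulNr opprK.
by field; rewrite d1 d2.
Qed.

Lemma unit_point_inj : injective unit_point.
Proof.
move=> m n /eqP; rewrite /unit_point eqr_div ?unit_point_denom// => /eqP E.
have : 'i * 2%:R * (m%:R - n%:R) = 0 :> C.
  transitivity ((1 + 'i * m%:R) * (1 - 'i * n%:R) - (1 + 'i * n%:R) * (1 - 'i * m%:R) : C); first by ring.
  by rewrite E subrr.
move/eqP; rewrite !mulf_eq0 (negPf (neq0Ci C)) pnatr_eq0 /= subr_eq0 eqr_nat.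
by move/eqP.
Qed.

Definition probe i j (w : C) : 'cV[C]_N := delta_mx i 0 + w *: delta_mx j 0.

Lemma qform_probe A i j w :
  qform A (probe i j w) = A i i + w * A i j + w^* * A j i + w * w^* * A j j.
Proof.
have E l m : ((delta_mx 0 l : 'rV_N) *m A *m (delta_mx m 0 : 'cV_N)) 0 0 = A l m.
  by rewrite -mulmxA -rowE -colE !mxE.
have pT : (probe i j w) ^t* = (delta_mx 0 i : 'rV[C]_N) + w^* *: delta_mx 0 j.
  by rewrite /probe linearD linearZ /= !trmx_delta map_mxD map_mxZ !map_delta_mx.
rewrite /qform pT /probe !mulmxDl !mulmxDr -?scalemxAl -?scalemxAr -?scalemxAl.
rewrite ![(_ + _ : 'M[C]_1) 0 0]mxE ![(_ *: _ : 'M[C]_1) 0 0]mxE !E.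
by ring.
Qed.

Definition fourth_roots : seq C := [:: 1; -1; 'i; - 'i].

(** In the sum over the fourth roots of unity w every term in which w and its
    conjugate occur with unequal exponents cancels. What is left are the two
    full contractions of A and B, up to a diagonal term. *)
Lemma sum_qform_probe A B :
  \sum_i \sum_j \sum_(w <- fourth_roots) qform A (probe i j w) * qform B (probe i j w) =
  8%:R * (\tr A * \tr B + \tr (A *m B)) + (8 * N)%:R * \sum_i A i i * B i i.
Proof.
transitivity (\sum_i \sum_j 4%:R * (A i i * B j j + A j j * B i i + A i j * B j i + A j i * B i j +
   (A i i * B i i + A j j * B j j))).
  apply: eq_bigr => i _; apply: eq_bigr => j _.
  have c1 : (1 : C)^* = 1 by rewrite rmorph1.
  have cN1 : (- 1 : C)^* = - 1 by rewrite rmorphN1.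
  have cNi : (- 'i : C)^* = 'i by rewrite rmorphN /= conjCi opprK.
  rewrite !big_cons big_nil !qform_probe c1 cN1 cNi conjCi.
  have := sqrCi C; rewrite expr2; move: 'i => w ww.
  ring: ww.
have trtr : \sum_i \sum_j A i i * B j j = \tr A * \tr B.
  by rewrite /mxtrace mulr_suml; apply: eq_bigr => i _; rewrite mulr_sumr.
have trM : \sum_i \sum_j A i j * B j i = \tr (A *m B).
  by apply: eq_bigr => i _; rewrite mxE.
have const F : \sum_(i < N) \sum_(j < N) F i = N%:R * \sum_i F i :> C.
  rewrite mulr_sumr; apply: eq_bigr => i _.
  by rewrite sumr_const card_ord mulr_natl.
under eq_bigr => i _ do rewrite -mulr_sumr !big_split /=.
rewrite -mulr_sumr !big_split /= trtr trM const.
rewrite [X in _ + X + _ + _ + _]exchange_big trtr /=.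
rewrite [X in _ + X + _]exchange_big trM /=.
rewrite [X in _ + (_ + X)]exchange_big const natrM /=.
by ring.
Qed.

Lemma sum_sqnorm_probe :
  \sum_i \sum_j \sum_(w <- fourth_roots) sqnorm (probe i j w) ^+ 2 =
  (8 * N)%:R + (16 * (N * N))%:R :> C.
Proof.
under eq_bigr => i _ do under eq_bigr => j _ do under eq_bigr => w _ do rewrite expr2.
rewrite sum_qform_probe mulmx1 mxtrace1.
under eq_bigr => i _ do rewrite mxE eqxx mulr1n mulr1.
by rewrite sumr_const card_ord !natrM; ring.
Qed.

End Unitary.

(** * Integration of bounded functions on the unitary group *)

From mathcomp Require Import complex finmap.
From mathcomp Require Import all_classical all_reals all_analysis.
From mathcomp Require Import measurable_realfun.
Import numFieldNormedType.Exports.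
Import Order.TTheory GRing.Theory Num.Theory.

Local Open Scope classical_set_scope.
Local Open Scope complex_scope.

Section UnitaryTopology.
Variables (R : realType) (N : nat).
Local Notation UN := (unitary_group R N).

Lemma continuous_entry i j :
  continuous (fun U : UN => (unitary_mx U : 'M[R[i]^o]_N) i j : R[i]^o).
Proof.
move=> U; apply: (@continuous_comp UN 'M[R[i]^o]_N R[i]^o
   (fun U : UN => unitary_mx U : 'M[R[i]^o]_N) (fun M => M i j)).
  exact: (@initial_continuous UN 'M[R[i]^o]_N (@set_val _ (@unitary_set R N))).
exact: coord_continuous.
Qed.

Lemma continuous_Re : continuous (fun z : R[i]^o => complex.Re z : R).
Proof.
move=> z A /nbhs_ballP[e /= e0 eA].
have e0' : 0 < (e%:C : R[i]) by rewrite ltcR.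
apply/nbhs_ballP; exists (e%:C : R[i]) => // w zw; apply: eA.
move: zw; rewrite /ball /= normc_def ltcR; apply: le_lt_trans.
by rewrite -sqrtr_sqr ler_wsqrtr// raddfB /= lerDl sqr_ge0.
Qed.

Lemma continuous_Im : continuous (fun z : R[i]^o => complex.Im z : R).
Proof.
move=> z A /nbhs_ballP[e /= e0 eA].
have e0' : 0 < (e%:C : R[i]) by rewrite ltcR.
apply/nbhs_ballP; exists (e%:C : R[i]) => // w zw; apply: eA.
move: zw; rewrite /ball /= normc_def ltcR; apply: le_lt_trans.
by rewrite -sqrtr_sqr ler_wsqrtr// -(raddfB (@complex.Im R)) lerDr sqr_ge0.
Qed.

(** The topology is induced by the entries, and those of VU are linear in those
    of U. *)
Lemma continuous_unitary_mul (V : UN) : continuous (unitary_mul V : UN -> UN).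
Proof.
apply: (@continuous_comp_initial UN UN 'M[R[i]^o]_N (@set_val _ (@unitary_set R N))).
move=> U A [P nP PA].
pose term i j l (W : UN) : R[i]^o :=
  (unitary_mx V i l : R[i]^o) *: ((unitary_mx W : 'M[R[i]^o]_N) l j : R[i]^o).
have cterm i j l : continuous (term i j l).
  move=> W; apply: (@continuous_comp UN R[i]^o R[i]^o _ (fun z => (unitary_mx V i l) *: z)).
    exact: continuous_entry.
  exact: (@scaler_continuous _ (R[i]^o)).
have cont i j : continuous (fun W : UN => \sum_l term i j l W : R[i]^o).
  have ac : continuous (fun z : R[i]^o * R[i]^o => z.1 + z.2 : R[i]^o) by exact: add_continuous.
  by apply: (continuous_big ac) => l _; exact: cterm.
have : \forall W \near U, forall i j, P i j (\sum_l term i j l W).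
  have FU : Filter (nbhs U) by exact: nbhs_filter.
  apply: (filter_forall (F := nbhs U)) => i; apply: (filter_forall (F := nbhs U)) => j.
  apply: cont; have := nP i j; by rewrite mxE.
apply: filterS => W PW; apply: PA => i j; have := PW i j.
by rewrite mxE.
Qed.

Lemma measurable_continuous (f : borel_unitary R N -> R) :
  continuous (f : UN -> R) -> measurable_fun setT f.
Proof.
move=> /continuousP cf; apply: (measurability _ (measurable_realfun.RGenOpens.measurableE R)).
move=> _ [_ [a [b ->] <-]]; rewrite setTI; apply: sub_sigma_algebra.
exact/cf/interval_open.
Qed.

Lemma measurable_unitary_mul (V : borel_unitary R N) :
  measurable_fun setT (unitary_mul V : borel_unitary R N -> borel_unitary R N).
Proof.
apply: (@measurability _ _ (borel_unitary R N) (borel_unitary R N) setT (unitary_mul V) (@open UN)) => // _ [B oB <-].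
rewrite setTI; apply: sub_sigma_algebra.
by have /continuousP := @continuous_unitary_mul V; apply.
Qed.
End UnitaryTopology.

Section HaarIntegral.
Variables (R : realType) (N : nat) (mu : probability (borel_unitary R N) R).
Local Notation T := (borel_unitary R N).
Implicit Types (f g : T -> R[i]) (u v : T -> R).

(** Bounded measurable functions are integrable and stable under products,
    which makes every polynomial in the entries and their conjugates
    integrable. *)
Definition bmfun u := measurable_fun setT u /\ exists B, forall U, `|u U| <= B.

Lemma bmfun_cst c : bmfun (fun=> c).
Proof. by split; [exact: measurable_cst | exists `|c|]. Qed.

Lemma bmfunD u v : bmfun u -> bmfun v -> bmfun (fun U => u U + v U).
Proof.
move=> [mu1 [B uB]] [mv [B' vB]]; split; first exact: measurable_funD.
by exists (B + B') => U; rewrite (le_trans (ler_normD _ _))// lerD.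
Qed.

Lemma bmfunM u v : bmfun u -> bmfun v -> bmfun (fun U => u U * v U).
Proof.
move=> [mu1 [B uB]] [mv [B' vB]]; split; first exact: measurable_funM.
by exists (B * B') => U; rewrite normrM ler_pM.
Qed.

Lemma bmfunN u : bmfun u -> bmfun (fun U => - u U).
Proof.
move=> bu; rewrite (_ : (fun U => - u U) = (fun U => -1 * u U)).
  exact: bmfunM (bmfun_cst _) bu.
by apply/funext => U; rewrite mulN1r.
Qed.

Lemma bmfun_integrable u : bmfun u -> mu.-integrable setT (EFin \o u).
Proof.
move=> [mu1 [B uB]]; apply: measurable_bounded_integrable => //.
  by rewrite [X in (X < _)%E](_ : _ = 1%E) ?ltry//; exact: probability_setT.
by exists B; split; [exact: num_real|move=> M BM U _; exact: le_trans (uB U) (ltW BM)].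
Qed.

Definition cbmfun f := bmfun (fun U => complex.Re (f U)) /\ bmfun (fun U => complex.Im (f U)).

Lemma cbmfun_cst c : cbmfun (fun=> c).
Proof. by split; exact: bmfun_cst. Qed.

Lemma cbmfunD f g : cbmfun f -> cbmfun g -> cbmfun (fun U => f U + g U).
Proof.
move=> [fr fi] [gr gi]; split.
  by under eq_fun do rewrite raddfD; exact: bmfunD.
by under eq_fun do rewrite raddfD; exact: bmfunD.
Qed.

Lemma ReM (z w : R[i]) : complex.Re (z * w) = complex.Re z * complex.Re w - complex.Im z * complex.Im w.
Proof. by case: z w => [a b] [c d]. Qed.

Lemma ImM (z w : R[i]) : complex.Im (z * w) = complex.Re z * complex.Im w + complex.Im z * complex.Re w.
Proof. by case: z w => [a b] [c d]. Qed.

Lemma cbmfunM f g : cbmfun f -> cbmfun g -> cbmfun (fun U => f U * g U).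
Proof.
move=> [fr fi] [gr gi]; split.
  under eq_fun do rewrite ReM.
  by apply: bmfunD; [exact: bmfunM | apply: bmfunN; exact: bmfunM].
by under eq_fun do rewrite ImM; apply: bmfunD; exact: bmfunM.
Qed.

Lemma cbmfun_conj f : cbmfun f -> cbmfun (fun U => ((f U)^*)%R).
Proof.
move=> [fr fi]; split.
  rewrite (_ : (fun U => complex.Re ((f U)^*)%R) = (fun U => complex.Re (f U)))//.
  by apply/funext => U; case: (f U).
rewrite (_ : (fun U => complex.Im ((f U)^*)%R) = (fun U => - complex.Im (f U))).
  exact: bmfunN.
by apply/funext => U; case: (f U).
Qed.

Lemma cbmfun_sum (I : Type) (r : seq I) (P : pred I) (F : I -> T -> R[i]) :
  (forall i, P i -> cbmfun (F i)) -> cbmfun (fun U => \sum_(i <- r | P i) F i U).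
Proof.
move=> bF; elim: r => [|i r IH].
  by under eq_fun do rewrite big_nil; exact: cbmfun_cst.
under eq_fun do rewrite big_cons; case: (boolP (P i)) => // Pi.
by apply: cbmfunD => //; exact: bF.
Qed.

Lemma cbmfun_prod (I : Type) (r : seq I) (P : pred I) (F : I -> T -> R[i]) :
  (forall i, P i -> cbmfun (F i)) -> cbmfun (fun U => \prod_(i <- r | P i) F i U).
Proof.
move=> bF; elim: r => [|i r IH].
  by under eq_fun do rewrite big_nil; exact: cbmfun_cst.
under eq_fun do rewrite big_cons; case: (boolP (P i)) => // Pi.
by apply: cbmfunM => //; exact: bF.
Qed.

(** The rows of a unitary matrix have norm 1. *)
Lemma unitary_entry_le (U : T) i j : `|unitary_mx U i j| <= 1.
Proof.
have /unitarymxP/matrixP/(_ i i) := unitary_mxP U.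
rewrite !mxE eqxx (bigD1 j)//= !mxE -normCK => E.
have : `|unitary_mx U i j| ^+ 2 <= 1.
  rewrite -[leRHS]E lerDl sumr_ge0// => l _.
  by rewrite !mxE -normCK exprn_ge0.
by rewrite expr_le1.
Qed.

Lemma cbmfun_entry i j : cbmfun (fun U : T => unitary_mx U i j).
Proof.
have bd (U : T) : `|complex.Re (unitary_mx U i j)| <= 1 /\ `|complex.Im (unitary_mx U i j)| <= 1.
  have := unitary_entry_le U i j; rewrite normc_def -(_ : 1%:C = 1)// lecR => H.
  split; apply: le_trans H; rewrite -sqrtr_sqr ler_wsqrtr//.
    by rewrite lerDl sqr_ge0.
  by rewrite lerDr sqr_ge0.
split; split; try by exists 1 => U; case: (bd U).
  apply: measurable_continuous => U.
  apply: (@continuous_comp (unitary_group R N) R[i]^o R (fun U => unitary_mx U i j) (@complex.Re R)).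
    exact: continuous_entry.
  exact: continuous_Re.
apply: measurable_continuous => U.
apply: (@continuous_comp (unitary_group R N) R[i]^o R (fun U => unitary_mx U i j) (@complex.Im R)).
  exact: continuous_entry.
exact: continuous_Im.
Qed.

Definition cint f : R[i] :=
  (\int[mu]_U complex.Re (f U))%R +i* (\int[mu]_U complex.Im (f U))%R.

Lemma eq_cint f g : f =1 g -> cint f = cint g.
Proof. by move=> /funext ->. Qed.

Lemma cint_cst c : cint (fun=> c) = c.
Proof.
rewrite /cint !Rintegral_cst//.
rewrite [X in fine X](_ : _ = 1%E); last exact: probability_setT.
by rewrite !mulr1; case: c.
Qed.

Lemma cintD f g : cbmfun f -> cbmfun g -> cint (fun U => f U + g U) = cint f + cint g.
Proof.
move=> [fr fi] [gr gi]; rewrite /cint.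
under eq_Rintegral do rewrite raddfD /=.
under [X in _ +i* X = _]eq_Rintegral do rewrite raddfD /=.
by rewrite !RintegralD//; exact: bmfun_integrable.
Qed.

Lemma cintZ c f : cbmfun f -> cint (fun U => c * f U) = c * cint f.
Proof.
move=> [fr fi]; rewrite /cint.
under eq_Rintegral do rewrite ReM.
under [X in _ +i* X = _]eq_Rintegral do rewrite ImM.
have I1 (a : R) u : bmfun u -> mu.-integrable setT (EFin \o (fun U => a * u U)).
  by move=> bu; apply: bmfun_integrable; apply: bmfunM => //; exact: bmfun_cst.
rewrite RintegralB ?RintegralD ?RintegralZl//; try exact: I1; try exact: bmfun_integrable.
by case: c.
Qed.

Lemma cint_sum (I : Type) (r : seq I) (P : pred I) (F : I -> T -> R[i]) :
  (forall i, P i -> cbmfun (F i)) ->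
  cint (fun U => \sum_(i <- r | P i) F i U) = \sum_(i <- r | P i) cint (F i).
Proof.
move=> bF; elim: r => [|i r IH].
  by rewrite big_nil -[RHS]cint_cst; apply: eq_cint => U; rewrite big_nil.
rewrite big_cons -IH; case: (boolP (P i)) => Pi.
  rewrite -cintD; [|exact: bF|exact: cbmfun_sum].
  by apply: eq_cint => U; rewrite big_cons Pi.
by apply: eq_cint => U; rewrite big_cons (negPf Pi).
Qed.

Hypothesis haar : is_haar mu.

Definition unitary_inv (V : T) : T :=
  unitary_of (etrans (trmxC_unitary (unitary_mx V)) (unitary_mxP V)).

Lemma unitary_group_inj (U V : T) : unitary_mx U = unitary_mx V -> U = V.
Proof. by move=> E; exact: val_inj. Qed.

Lemma unitary_mx_mul (V U : T) :
  unitary_mx (unitary_mul V U) = unitary_mx V *m unitary_mx U.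
Proof. by []. Qed.

Lemma unitary_mx_inv (V : T) : unitary_mx (unitary_inv V) = invmx (unitary_mx V).
Proof. by rewrite invmx_unitary ?unitary_mxP. Qed.

Lemma unitary_invK (V : T) : cancel (unitary_mul V) (unitary_mul (unitary_inv V)).
Proof.
move=> U; apply: unitary_group_inj; rewrite !unitary_mx_mul unitary_mx_inv.
by rewrite mulKmx// unitarymx_unit// unitary_mxP.
Qed.

Lemma unitary_mulVK (V : T) : cancel (unitary_mul (unitary_inv V)) (unitary_mul V).
Proof.
move=> U; apply: unitary_group_inj; rewrite !unitary_mx_mul unitary_mx_inv.
by rewrite mulKVmx// unitarymx_unit// unitary_mxP.
Qed.

(** The preimage of a set under the translation by V is its image under the
    translation by the inverse of V, so the pushforward of the measure is
    the measure itself. *)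
Lemma Rintegral_translate (V : T) u : bmfun u ->
  (\int[mu]_U u (unitary_mul V U))%R = (\int[mu]_U u U)%R.
Proof.
move=> bu; have [mu1 [B uB]] := bu; have mV := measurable_unitary_mul V.
have bV : bmfun (fun U => u (unitary_mul V U)).
  split; last by exists B => U.
  exact: (measurableT_comp mu1 mV).
rewrite /Rintegral; congr fine.
have := @integral_pushforward _ _ T T R _ mV mu setT (EFin \o u).
rewrite preimage_setT /= => <- //; last first.
- exact: (bmfun_integrable bV).
- exact/measurable_EFinP.
apply: eq_measure_integral => A mA _; rewrite /pushforward.
refine (etrans _ (haar (unitary_inv V) mA)); congr (mu _).
apply/seteqP; split=> [U /= AU|_ [U AU <-]] /=.
  by exists (unitary_mul V U) => //; exact: unitary_invK.
by rewrite unitary_mulVK.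
Qed.

Lemma cint_translate (V : T) f : cbmfun f ->
  cint (fun U => f (unitary_mul V U)) = cint f.
Proof.
by move=> [fr fi]; rewrite /cint (Rintegral_translate V fr) (Rintegral_translate V fi).
Qed.

End HaarIntegral.

(** * Recursion for the Haar moments *)

Section Measurability.
Variables (R : realType) (N : nat).
Local Notation T := (borel_unitary R N).
Local Notation mx U := (unitary_mx (U : T)).

Lemma cbmfunX (f : T -> R[i]) d : cbmfun f -> cbmfun (fun U => f U ^+ d).
Proof.
move=> bf; elim: d => [|d IH]; first exact: cbmfun_cst.
by under eq_fun do rewrite exprS; exact: cbmfunM.
Qed.

Lemma cbmfun_coef_prod (I : Type) (r : seq I) (F : I -> T -> {poly R[i]}) :
  (forall i d, cbmfun (fun U => (F i U)`_d)) ->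
  forall d, cbmfun (fun U => (\prod_(i <- r) F i U)`_d).
Proof.
move=> bF; elim: r => [|i r IH] d.
  by under eq_fun do rewrite big_nil; exact: cbmfun_cst.
under eq_fun do rewrite big_cons coefM.
by apply: cbmfun_sum => j _; exact: cbmfunM.
Qed.

Lemma cbmfun_det : cbmfun (fun U => \det (mx U)).
Proof.
apply: cbmfun_sum => s _; apply: cbmfunM; first exact: cbmfun_cst.
by apply: cbmfun_prod => i _; exact: cbmfun_entry.
Qed.

Lemma cbmfun_sec d : cbmfun (fun U => sec (mx U) d).
Proof.
under eq_fun do rewrite /sec /determinant coef_sum.
apply: cbmfun_sum => s _.
have E (U : T) : ((-1) ^+ s * \prod_i (1%:M + 'X *: map_mx polyC (mx U)) i (s i))`_d =
   (-1) ^+ s * (\prod_i (1%:M + 'X *: map_mx polyC (mx U)) i (s i))`_d.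
  by case: (perm.odd_perm s); rewrite ?expr0 ?mul1r// expr1 !mulN1r coefN.
under eq_fun do rewrite E.
apply: cbmfunM; first exact: cbmfun_cst.
apply: cbmfun_coef_prod => i e.
under eq_fun do rewrite !mxE coefD coefXM.
apply: cbmfunD; first exact: cbmfun_cst.
case: e => [|e] /=; first exact: cbmfun_cst.
under eq_fun do rewrite coefC; case: (e == 0)%N; last exact: cbmfun_cst.
exact: cbmfun_entry.
Qed.

Lemma cbmfun_newton d i j : cbmfun (fun U => newton_mx (mx U) d i j).
Proof.
elim: d i j => [|d IH] i j.
  by under eq_fun do rewrite /= mxE; exact: cbmfun_cst.
under eq_fun do rewrite /= mxE [X in X + _]mxE [X in _ + X]mxE [X in _ - X]mxE.
apply: cbmfunD; first by apply: cbmfunM; [exact: cbmfun_sec|exact: cbmfun_entry].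
rewrite (_ : (fun U : T => _) = (fun U => -1 * \sum_l mx U i l * newton_mx (mx U) d l j)).
  apply: cbmfunM; first exact: cbmfun_cst.
  by apply: cbmfun_sum => l _; apply: cbmfunM; [exact: cbmfun_entry|exact: IH].
by apply/funext => U; rewrite mulN1r.
Qed.

Lemma cbmfun_qform d (v : 'cV[R[i]]_N) : cbmfun (fun U => qform (newton_mx (mx U) d) v).
Proof.
under eq_fun do rewrite /qform mxE.
apply: cbmfun_sum => j _; apply: cbmfunM; last exact: cbmfun_cst.
under eq_fun do rewrite mxE.
apply: cbmfun_sum => l _; apply: cbmfunM; first exact: cbmfun_cst.
exact: cbmfun_newton.
Qed.

End Measurability.

Section HaarMoments.
Variables (R : realType) (N : nat) (mu : probability (borel_unitary R N) R).
Hypothesis haar : is_haar mu.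
Variables (k n : nat).
Local Notation T := (borel_unitary R N).
Local Notation mx U := (unitary_mx (U : T)).
Implicit Types (p : {ffun 'I_n -> nat}) (v : 'cV[R[i]]_N) (f : T -> R[i]).

(** The power of the conjugate determinant that remains when the k conjugated
    secular coefficients are replaced by conj_sec. *)
Definition twist (U : T) : R[i] := ((\det (mx U))^*)%R ^+ k.

Definition twisted_int f : R[i] := cint mu (fun U => f U * twist U).

Definition moment p : R[i] := twisted_int (fun U => \prod_c sec (mx U) (p c)).

Lemma cbmfun_twist : cbmfun twist.
Proof. by apply: cbmfunX; apply: cbmfun_conj; exact: cbmfun_det. Qed.

Lemma eq_twisted_int f g : f =1 g -> twisted_int f = twisted_int g.
Proof. by move=> /funext ->. Qed.

Lemma twisted_intZ c f : cbmfun f -> twisted_int (fun U => c * f U) = c * twisted_int f.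
Proof.
move=> bf; rewrite /twisted_int -cintZ; last exact: cbmfunM bf cbmfun_twist.
by apply: eq_cint => U; rewrite mulrA.
Qed.

Lemma twisted_int_sum (I : Type) (r : seq I) (P : pred I) (F : I -> T -> R[i]) :
  (forall i, P i -> cbmfun (F i)) ->
  twisted_int (fun U => \sum_(i <- r | P i) F i U) = \sum_(i <- r | P i) twisted_int (F i).
Proof.
move=> bF; rewrite /twisted_int -cint_sum; first by apply: eq_cint => U; rewrite mulr_suml.
by move=> i Pi; apply: cbmfunM; [exact: bF|exact: cbmfun_twist].
Qed.

Lemma twisted_intD f g : cbmfun f -> cbmfun g ->
  twisted_int (fun U => f U + g U) = twisted_int f + twisted_int g.
Proof.
move=> bf bg; rewrite /twisted_int -cintD; [|exact: cbmfunM bf cbmfun_twist|exact: cbmfunM bg cbmfun_twist].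
by apply: eq_cint => U; rewrite mulrDl.
Qed.

Lemma cbmfun_prod_sec p (P : pred 'I_n) : cbmfun (fun U : T => \prod_(c | P c) sec (mx U) (p c)).
Proof. by apply: cbmfun_prod => c _; exact: cbmfun_sec. Qed.

(** The product of the secular coefficients of AU, for a reflection A along v, as
    a polynomial in the coefficient of the rank one part of A. *)
Definition qpoly p v (U : T) : {poly R[i]} :=
  \prod_c ((sec (mx U) (p c))%:P + (qform (newton_mx (mx U) (p c)) v)%:P * 'X).

Lemma cbmfun_qpoly p v d : cbmfun (fun U => (qpoly p v U)`_d).
Proof.
apply: cbmfun_coef_prod => c e.
under eq_fun do rewrite coefD coefC coefMX coefC.
apply: cbmfunD; first by case: (e == 0)%N; [exact: cbmfun_sec|exact: cbmfun_cst].
case: e => [|e] /=; first exact: cbmfun_cst.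
by case: (e == 0)%N; [exact: cbmfun_qform|exact: cbmfun_cst].
Qed.

Lemma size_qpoly p v U : (size (qpoly p v U) <= n.+1)%N.
Proof.
apply: leq_trans (size_poly_prod_leq _ _) _.
have H : (\sum_(c < n) size ((sec (mx U) (p c))%:P +
    (qform (newton_mx (mx U) (p c)) v)%:P * 'X)%R <= \sum_(c < n) 2)%N.
  apply: leq_sum => c _; rewrite (leq_trans (size_polyD _ _))// geq_max; apply/andP; split.
    by rewrite (leq_trans (size_polyC_leq1 _)).
  by rewrite mul_polyC (leq_trans (size_scale_leq _ _))// size_polyX.
move: H; rewrite sum_nat_const card_ord => H.
by rewrite leq_subLR addnS ltnS (leq_trans H)// muln2 addnn.
Qed.

(** Translation by a reflection of determinant z multiplies the twist by
    conj(z)^k, and z^k is a power of an affine function of the parameter. Both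
    sides are polynomials that agree at infinitely many parameters. The degree
    is at most n; the bound n + 3 keeps the coefficient of degree 2 in range
    when n < 2. *)
Lemma twisted_int_reflection p v : v != 0 ->
  \poly_(j < n.+3) twisted_int (fun U => (qpoly p v U)`_j) =
  (1 + (sqnorm v)%:P * 'X) ^+ k * (moment p)%:P.
Proof.
move=> v0; have s0 : sqnorm v != 0 by rewrite sqnorm_eq0.
apply: (@poly_eq_inj _ (fun j => (unit_point R[i] j - 1) / sqnorm v)) => [i j|j].
  by move=> /(mulIf (invr_neq0 s0))/addIr/unit_point_inj.
set z := unit_point _ j; set t := _ / _; have zz : z * (z^*)%R = 1 by exact: unit_pointK.
have tz : 1 + sqnorm v * t = z by rewrite /t mulrC divfK// addrC subrK.
rewrite hornerM horner_exp hornerD hornerM !hornerC hornerX tz.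
have rU := reflection_unitary v0 zz; pose V : T := unitary_of rU.
have <- : twisted_int (fun U => (qpoly p v U).[t]) = z ^+ k * moment p.
  rewrite /moment /twisted_int -[in RHS](cint_translate haar V); last first.
    by apply: cbmfunM cbmfun_twist; exact: cbmfun_prod_sec.
  rewrite -cintZ; last first.
    apply: cbmfunM.
      apply: cbmfun_prod => c _.
      under eq_fun do rewrite unitary_mx_mul sec_reflection.
      apply: cbmfunD; first exact: cbmfun_sec.
      by apply: cbmfunM; [exact: cbmfun_cst|exact: cbmfun_qform].
    apply: cbmfunX; apply: cbmfun_conj; under eq_fun do rewrite unitary_mx_mul det_mulmx.
    by apply: cbmfunM; [exact: cbmfun_cst|exact: cbmfun_det].
  apply: eq_cint => U; rewrite /twist unitary_mx_mul det_mulmx det_reflection//.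
  have cancel (a b c d : R[i]) : a * b = 1 -> a * (c * (b * d)) = c * d.
    by move=> ab; rewrite mulrCA [a * _]mulrA ab mul1r.
  rewrite [X in _ = _ * (_ * X)](_ : _ = (z^*)%R ^+ k * twist U); last by rewrite rmorphM [LHS]exprMn.
  rewrite cancel; last by rewrite -exprMn zz expr1n.
  congr (_ * _); rewrite /qpoly horner_prod; apply: eq_bigr => c _.
  by rewrite hornerD hornerM !hornerC hornerX sec_reflection mulrC.
rewrite horner_poly.
transitivity (twisted_int (fun U => \sum_(j < n.+3) t ^+ j * (qpoly p v U)`_j)); last first.
  apply: eq_twisted_int => U; rewrite (horner_coef_wide _ (_ : size _ <= n.+3)%N).
    by apply: eq_bigr => l _; rewrite mulrC.
  by rewrite (leq_trans (size_qpoly _ _ _))// !ltnS !leqW.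
rewrite twisted_int_sum => [|l _]; last by apply: cbmfunM; [exact: cbmfun_cst|exact: cbmfun_qpoly].
by apply: eq_bigr => l _; rewrite twisted_intZ ?[t ^+ l * _]mulrC//; exact: cbmfun_qpoly.
Qed.

(** Compare coefficients of degree 2 in twisted_int_reflection. *)
Lemma twisted_int_qform2 p v :
  twisted_int (fun U => \sum_a \sum_(b | b != a)
     qform (newton_mx (mx U) (p a)) v * qform (newton_mx (mx U) (p b)) v *
     \prod_(c | (c != a) && (c != b)) sec (mx U) (p c)) =
  (k * k.-1)%:R * sqnorm v ^+ 2 * moment p.
Proof.
have [->|v0] := eqVneq v 0.
  have q0 A : qform A 0 = 0 :> R[i] by rewrite /qform mulmx0 mxE.
  rewrite /sqnorm q0 expr0n mulr0 mul0r -[RHS](cint_cst mu); apply: eq_cint => U.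
  by rewrite big1 ?mul0r// => a _; rewrite big1// => b _; rewrite q0 !mul0r.
transitivity (twisted_int (fun U => (qpoly p v U)`_2) *+ 2).
  rewrite -mulr_natl -twisted_intZ; last exact: cbmfun_qpoly.
  by apply: eq_twisted_int => U; rewrite mulr_natl /qpoly coef2_prod_affine.
have -> : twisted_int (fun U => (qpoly p v U)`_2) = (\poly_(j < n.+3) twisted_int (fun U => (qpoly p v U)`_j))`_2.
  by rewrite coef_poly.
by rewrite twisted_int_reflection// coefMC -mulrnAl coef2_affineX.
Qed.

(** The vectors probe i j w turn the products of quadratic forms into the two
    contractions of T_a and T_b plus a diagonal term, and the basis vectors
    dispose of the latter. *)
Lemma moment_casimir p :
  twisted_int (fun U => \sum_a \sum_(b | b != a)
     (\tr (newton_mx (mx U) (p a)) * \tr (newton_mx (mx U) (p b)) +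
      \tr (newton_mx (mx U) (p a) *m newton_mx (mx U) (p b))) *
     \prod_(c | (c != a) && (c != b)) sec (mx U) (p c)) =
  (k * k.-1 * (N * N.+1))%:R * moment p.
Proof.
pose Q h := twisted_int (fun U => \sum_a \sum_(b | b != a) h a b U *
   \prod_(c | (c != a) && (c != b)) sec (mx U) (p c)).
pose good (h : 'I_n -> 'I_n -> T -> R[i]) := forall a b, cbmfun (h a b).
have bQ h : good h -> cbmfun (fun U => \sum_a \sum_(b | b != a) h a b U *
   \prod_(c | (c != a) && (c != b)) sec (mx U) (p c)).
  move=> gh; apply: cbmfun_sum => a _; apply: cbmfun_sum => b _.
  by apply: cbmfunM; [exact: gh|exact: cbmfun_prod_sec].
have Qsum (I : Type) (r : seq I) (h : I -> 'I_n -> 'I_n -> T -> R[i]) :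
    (forall i, good (h i)) -> Q (fun a b U => \sum_(i <- r) h i a b U) = \sum_(i <- r) Q (h i).
  move=> gh; rewrite /Q -twisted_int_sum; last by move=> i _; exact: bQ.
  apply: eq_twisted_int => U; rewrite exchange_big; apply: eq_bigr => a _ /=.
  by rewrite exchange_big; apply: eq_bigr => b _ /=; rewrite mulr_suml.
have QD h h' : good h -> good h' -> Q (fun a b U => h a b U + h' a b U) = Q h + Q h'.
  move=> gh gh'; rewrite /Q -twisted_intD; [|exact: bQ|exact: bQ].
  apply: eq_twisted_int => U; rewrite -big_split; apply: eq_bigr => a _ /=.
  by rewrite -big_split; apply: eq_bigr => b _ /=; rewrite mulrDl.
have QZ x h : good h -> Q (fun a b U => x * h a b U) = x * Q h.
  move=> gh; rewrite /Q -twisted_intZ; last exact: bQ.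
  apply: eq_twisted_int => U; rewrite mulr_sumr; apply: eq_bigr => a _.
  by rewrite mulr_sumr; apply: eq_bigr => b _; rewrite mulrA.
pose Tm a U := newton_mx (mx U) (p a).
pose qq v a b (U : T) := qform (Tm a U) v * qform (Tm b U) v.
have gqq v : good (qq v) by move=> a b; apply: cbmfunM; exact: cbmfun_qform.
pose dd a b (U : T) := \sum_i Tm a U i i * Tm b U i i.
have gdi i : good (fun a b U => Tm a U i i * Tm b U i i).
  by move=> a b; apply: cbmfunM; exact: cbmfun_newton.
pose tt a b (U : T) := \tr (Tm a U) * \tr (Tm b U) + \tr (Tm a U *m Tm b U).
have gdd : good dd by move=> a b; apply: cbmfun_sum => i _; exact: gdi.
have gtt : good tt.
  move=> a b; apply: cbmfunD.
    by apply: cbmfunM; apply: cbmfun_sum => i _; exact: cbmfun_newton.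
  apply: cbmfun_sum => i _; under eq_fun do rewrite mxE.
  by apply: cbmfun_sum => j _; apply: cbmfunM; exact: cbmfun_newton.
rewrite -/(Q tt).
have Qqq v : Q (qq v) = (k * k.-1)%:R * sqnorm v ^+ 2 * moment p by exact: twisted_int_qform2.
have Qdd : Q dd = (k * k.-1)%:R * N%:R * moment p.
  rewrite /dd Qsum// (eq_bigr (fun=> (k * k.-1)%:R * moment p)) ?sumr_const ?card_ord => [|i _].
    by rewrite -mulr_natl; ring.
  have := Qqq (delta_mx i 0).
  have qd A : qform A (delta_mx i 0) = A i i :> R[i].
    have := qform_probe A i i 0; rewrite /probe scale0r addr0 => ->.
    by rewrite conjC0 !mul0r !addr0.
  rewrite /sqnorm qd mxE eqxx expr1n mulr1 => <-.
  by congr Q; apply/funext => a; apply/funext => b; apply/funext => U; rewrite /qq !qd.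
have E : \sum_i \sum_j \sum_(w <- fourth_roots R[i]) Q (qq (probe i j w)) =
   8%:R * Q tt + (8 * N)%:R * Q dd.
  rewrite -QZ// -QZ// -QD; last 2 first.
  - by move=> a b; apply: cbmfunM; [exact: cbmfun_cst|exact: gtt].
  - by move=> a b; apply: cbmfunM; [exact: cbmfun_cst|exact: gdd].
  transitivity (Q (fun a b U => \sum_i \sum_j \sum_(w <- fourth_roots R[i]) qq (probe i j w) a b U)).
    rewrite Qsum; last by move=> i a b; apply: cbmfun_sum => j _; apply: cbmfun_sum => w _; exact: gqq.
    apply: eq_bigr => i _; rewrite Qsum; last by move=> j a b; apply: cbmfun_sum => w _; exact: gqq.
    by apply: eq_bigr => j _; rewrite Qsum.
  congr Q; apply/funext => a; apply/funext => b; apply/funext => U.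
  exact: sum_qform_probe.
have {E} : 8%:R * Q tt = 8%:R * ((k * k.-1 * (N * N.+1))%:R * moment p).
  (* with the diagonal term added, the left-hand side is the sum over probes *)
  apply: (addIr ((8 * N)%:R * Q dd)); rewrite -E Qdd.
  transitivity (((k * k.-1)%:R * moment p) *
    \sum_i \sum_j \sum_(w <- fourth_roots R[i]) sqnorm (@probe R[i] N i j w) ^+ 2).
    rewrite mulr_sumr; apply: eq_bigr => i _; rewrite mulr_sumr; apply: eq_bigr => j _.
    by rewrite mulr_sumr; apply: eq_bigr => w _; rewrite Qqq mulrAC.
  rewrite sum_sqnorm_probe !natrM -[N.+1]addn1 natrD.
  by ring.
by apply: mulfI; rewrite pnatr_eq0.
Qed.

Lemma moment_rec p : exchange_rec k N moment p.
Proof.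
rewrite /exchange_rec -moment_casimir.
have bP (q : {ffun 'I_n -> nat}) : cbmfun (fun U : T => \prod_c sec (mx U) (q c)) by exact: cbmfun_prod_sec.
have bZ x f : cbmfun f -> cbmfun (fun U : T => x * f U).
  by move=> bf; apply: cbmfunM => //; exact: cbmfun_cst.
rewrite [RHS](eq_twisted_int (fun U => casimir_expand (mx U) p)).
rewrite twisted_int_sum => [|a _]; last first.
  apply: cbmfun_sum => b _; apply: cbmfunD; first exact: bZ.
  by apply: cbmfun_sum => i _; exact: bZ.
apply: eq_bigr => a _; rewrite twisted_int_sum => [|b _]; last first.
  by apply: cbmfunD; [exact: bZ|apply: cbmfun_sum => i _; exact: bZ].
apply: eq_bigr => b _; rewrite twisted_intD; [|exact: bZ|by apply: cbmfun_sum => i _; exact: bZ].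
rewrite twisted_intZ// twisted_int_sum => [|i _]; last exact: bZ.
by congr (_ + _); apply: eq_bigr => i _; rewrite twisted_intZ.
Qed.

Lemma moment_big p : (exists c, N < p c)%N -> moment p = 0.
Proof.
move=> [c pc]; rewrite -[RHS](cint_cst mu); apply: eq_cint => U.
by rewrite (bigD1 c)//= sec_big// !mul0r.
Qed.

(** Only the secular coefficients 1 and det U occur, the latter k times. *)
Lemma moment_extreme p : (0 < N)%N -> (\sum_c p c = k * N)%N ->
  (forall c, p c = 0 \/ p c = N)%N -> moment p = 1.
Proof.
move=> N0 sp pe; rewrite -[RHS](cint_cst mu); apply: eq_cint => U.
have kE : k = (\sum_c (p c == N))%N.
  apply/eqP; rewrite -(eqn_pmul2r N0) -sp big_distrl; apply/eqP/eq_bigr => c _ /=.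
  by case: (pe c) => ->; rewrite ?eqxx ?mul1n// eq_sym (gtn_eqF N0).
have -> : \prod_c sec (mx U) (p c) = \det (mx U) ^+ k.
  rewrite [in RHS]kE -prodrXr; apply: eq_bigr => c _.
  by case: (pe c) => ->; rewrite ?sec0 ?sec_top ?eqxx// eq_sym (gtn_eqF N0).
by rewrite /twist -exprMn det_unitary_conj ?expr1n// unitary_mxP.
Qed.

(** Both sides satisfy the recursion and agree at the extreme contents. *)
Lemma moment_kostka p : (0 < N)%N -> (\sum_c p c = k * N)%N ->
  moment p = kostka R[i] N k p.
Proof.
move=> N0 sp; apply/eqP; rewrite -subr_eq0; apply/eqP.
pose M (p : {ffun 'I_n -> nat}) := moment p - kostka R[i] N k p.
apply: (@exchange_rec_eq0 R[i] n k N M) => // [q qN|q sq qe|q sq qN]; rewrite /M.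
- by rewrite moment_big// kostka_big// subrr.
- by rewrite moment_extreme// kostka_extreme// subrr.
rewrite /exchange_rec mulrBr -(moment_rec q) -(kostka_rec R[i] sq qN) -sumrB; apply: eq_bigr => a _.
rewrite -sumrB; apply: eq_bigr => b _; rewrite mulrBr opprD addrACA; congr (_ + _).
by rewrite -sumrB; apply: eq_bigr => i _; rewrite mulrBr.
Qed.

End HaarMoments.

(** * From moments to lattice points *)

Section Join.
Variables (k N : nat).
Implicit Types (i j : {ffun 'I_k -> 'I_N.+1}).

(** The content of the term of the squared modulus with indices i in the
    conjugated factor and j in the other one. *)
Definition moment_content i j : {ffun 'I_(k + k) -> nat} :=
  [ffun c => match fintype.split c with inl a => (N - i a)%N | inr b => j b : nat end].

Lemma moment_content_lshift i j a : moment_content i j (lshift k a) = (N - i a)%N.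
Proof. by rewrite ffunE (unsplitK (inl a)). Qed.

Lemma moment_content_rshift i j b : moment_content i j (rshift k b) = j b.
Proof. by rewrite ffunE (unsplitK (inr b)). Qed.

Lemma sum_compl i : (\sum_a (N - i a) + \sum_a i a = k * N)%N.
Proof.
rewrite -big_split (eq_bigr (fun=> N)) => [|a _]; first by rewrite sum_nat_const card_ord.
by have := ltn_ord (i a) => /=; lia.
Qed.

Lemma sum_moment_content i j : (\sum_a i a = \sum_a j a)%N -> (\sum_c moment_content i j c = k * N)%N.
Proof.
move=> ij; rewrite big_split_ord /=.
under eq_bigr do rewrite moment_content_lshift.
under [X in (_ + X)%N]eq_bigr do rewrite moment_content_rshift.
by rewrite -ij sum_compl.
Qed.

End Join.

(** The sizes of the strips of a chain determine i and j, and since the strips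
    have kN cells in all, the two conditions on m are the same. *)
Lemma count_moment_content K N (m : int) :
  let k := K.+1 in
  (\sum_(i : {ffun 'I_k -> 'I_N.+1} | (\sum_a (i a : nat))%N%:Z == m)
   \sum_(j : {ffun 'I_k -> 'I_N.+1} | (\sum_a (j a : nat))%N%:Z == m)
     #|[set l : (k + k).-tuple {set 'I_N} |
       [&& [forall c, #|tnth l c| == moment_content i j c], chain (@staircase N) l &
           [forall i, level l (k + k) i == k]]]%SET| =
  #|[set l : (k + k).-tuple {set 'I_N} | full_chain l &&
      ((\sum_(c < k) #|nth finset.set0 l c|)%N%:Z == (k * N)%N%:Z - m)%R]%SET|)%N.
Proof.
move=> k.
under eq_bigr => i _ do under eq_bigr => j _ do rewrite -sum1_card big_mkcond.
under eq_bigr => i _ do rewrite exchange_big.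
rewrite exchange_big -sum1_card [RHS]big_mkcond; apply: eq_bigr => l _ /=.
rewrite inE; case: (boolP (full_chain l)) => fl; last first.
  rewrite big1// => i _; rewrite big1// => j _.
  by rewrite inE -/(full_chain l) (negPf fl) andbF.
have card_le c : (#|tnth l c| <= N)%N by rewrite -[leqRHS]card_ord max_card.
(* the only indices whose content is that of l *)
pose I0 : {ffun 'I_k -> 'I_N.+1} := [ffun a => inord (N - #|tnth l (lshift k a)|)].
pose J0 : {ffun 'I_k -> 'I_N.+1} := [ffun b => inord #|tnth l (rshift k b)|].
have I0E a : I0 a = (N - #|tnth l (lshift k a)|)%N :> nat.
  by rewrite ffunE inordK// ltnS leq_subr.
have J0E b : J0 b = #|tnth l (rshift k b)| :> nat.
  by rewrite ffunE inordK// ltnS.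
have contentE i j : [forall c, #|tnth l c| == moment_content i j c] = ((i, j) == (I0, J0)).
  apply/forallP/eqP => [H|[-> ->] c].
    congr (_, _); apply/ffunP => a; apply: val_inj.
      have := H (lshift k a); rewrite moment_content_lshift /= I0E => /eqP ->.
      by rewrite subKn// -ltnS.
    by have := H (rshift k a); rewrite moment_content_rshift /= J0E => /eqP ->.
  case: (split_ordP c) => a ->.
    by rewrite moment_content_lshift I0E subKn.
  by rewrite moment_content_rshift J0E.
have [_ tot] := full_chainP _ fl.
have s1 : (\sum_(c < k) #|nth finset.set0 l c| = \sum_a #|tnth l (lshift k a)|)%N.
  by apply: eq_bigr => c _; rewrite (tnth_nth finset.set0).
have s2 : (\sum_a #|tnth l (lshift k a)| + \sum_b #|tnth l (rshift k b)| = k * N)%N.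
  transitivity (\sum_(c < k + k) #|tnth l c|)%N; first by rewrite [RHS]big_split_ord.
  rewrite (eq_bigr (fun c : 'I_(k + k) => #|nth finset.set0 l c|)) => [|c _].
    rewrite -sum_level (eq_bigr (fun=> k)) => [|a _]; last exact: tot.
    by rewrite sum_nat_const card_ord mulnC.
  by rewrite (tnth_nth finset.set0).
have s3 := sum_compl I0.
have s4 : (\sum_a (N - I0 a) = \sum_a #|tnth l (lshift k a)|)%N.
  by apply: eq_bigr => a _; rewrite I0E subKn.
have s5 : (\sum_b J0 b = \sum_b #|tnth l (rshift k b)|)%N by apply: eq_bigr => b _; rewrite J0E.
rewrite pair_big big_mkcond (bigD1 (I0, J0))//= [X in (_ + X)%N]big1 ?addn0 => [|[i j] ij]; last first.
  by rewrite /= inE contentE (negPf ij) /= if_same.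
rewrite inE contentE eqxx -/(full_chain l) fl /= s1 s5.
move: s2 s3 s4; rewrite -/k; move: (k * N)%N => q.
move: (\sum_a (N - I0 a))%N (\sum_a I0 a)%N
  (\sum_a #|tnth l (lshift k a)|)%N (\sum_b #|tnth l (rshift k b)|)%N => x1 x2 x3 x4 e1 e2 e3.
have -> : (x2%:Z == m) = (x3%:Z == q%:Z - m) by lia.
have -> : (x4%:Z == m) = (x3%:Z == q%:Z - m) by lia.
by rewrite andbb.
Qed.

Lemma card_lattice_points K N (m : int) :
  #|` fset_set (@lattice_points K.+1 N m)| =
  #|[set l : (K.+1 + K.+1).-tuple {set 'I_N} | full_chain l &&
      ((\sum_(c < K.+1) #|nth finset.set0 l c|)%N%:Z == (K.+1 * N)%N%:Z - m)]%SET|.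
Proof.
set B := [set l | _]%SET.
have BE l : (l \in B) = full_chain l &&
    ((\sum_(c < K.+1) #|nth finset.set0 l c|)%N%:Z == (K.+1 * N)%N%:Z - m).
  by rewrite inE.
have inj : {in B &, injective (@box K N)}.
  move=> l l'; rewrite !BE => /andP[fl _] /andP[fl' _]; exact: box_inj.
have -> : fset_set (@lattice_points K.+1 N m) = [fset box l | l in B]%fset.
  apply/fsetP => x; rewrite in_fset_set; last exact: finite_lattice_points.
  apply/idP/imfsetP => [/set_mem[bd diag [row col]]|[l /= lB ->]].
    have bx : box_like N x by split.
    exists (unbox N x); last by rewrite box_unbox.
    by rewrite /= BE full_unbox//= -diag -(box_diag (full_unbox bx)) box_unbox.
  move: lB; rewrite BE => /andP[fl /eqP diag]; apply/mem_set.
  have [bd row col] := box_likeP fl.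
  by split=> //; rewrite (box_diag fl).
by rewrite card_in_imfset//= cardE.
Qed.

Section Moment.
Variables (R : realType) (N : nat) (mu : probability (borel_unitary R N) R).
Hypothesis haar : is_haar mu.
Local Notation T := (borel_unitary R N).
Local Notation mx U := (unitary_mx (U : T)).

Lemma cbmfun_secular_sum k m : cbmfun (fun U : T => secular_sum k m (mx U)).
Proof. by apply: cbmfun_sum => j _; apply: cbmfun_prod => a _; exact: cbmfun_sec. Qed.

Lemma secular_moment_cint k m :
  secular_moment mu k m =
  (complex.Re (cint mu (fun U => secular_sum k m (mx U) * ((secular_sum k m (mx U))^*)%R)))%:E.
Proof.
have bS := cbmfun_secular_sum k m.
have [bR _] := cbmfunM bS (cbmfun_conj bS).
rewrite /= /Rintegral fineK; last exact/integrable_fin_num/bmfun_integrable.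
apply: eq_integral => U _; congr (_%:E).
case: (secular_sum k m (mx U)) => a b /=.
by rewrite sqr_sqrtr ?addr_ge0 ?sqr_ge0// mulrN opprK !expr2.
Qed.

Lemma secular_norm_expand k m (U : T) :
  secular_sum k m (mx U) * ((secular_sum k m (mx U))^*)%R =
  \sum_(i : {ffun 'I_k -> 'I_N.+1} | (\sum_a (i a : nat))%N%:Z == m)
   \sum_(j : {ffun 'I_k -> 'I_N.+1} | (\sum_a (j a : nat))%N%:Z == m)
     (\prod_c sec (mx U) (moment_content i j c)) * twist k U.
Proof.
rewrite rmorph_sum /= mulrC mulr_suml; apply: eq_bigr => i _.
rewrite mulr_sumr; apply: eq_bigr => j _.
rewrite big_split_ord /= rmorph_prod /=.
under [in RHS]eq_bigr do rewrite moment_content_lshift.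
under [X in _ * X * _]eq_bigr do rewrite moment_content_rshift.
rewrite (eq_bigr (fun a => ((\det (mx U))^*)%R * sec (mx U) (N - i a))) => [|a _]; last first.
  by rewrite -conj_sec ?unitary_mxP// -ltnS.
rewrite big_split /= prodr_const card_ord /twist.
by rewrite [RHS]mulrC [RHS]mulrA.
Qed.
Lemma secular_moment_chains K m : (0 < N)%N ->
  secular_moment mu K.+1 m =
  (#|[set l : (K.+1 + K.+1).-tuple {set 'I_N} | full_chain l &&
      ((\sum_(c < K.+1) #|nth finset.set0 l c|)%N%:Z == (K.+1 * N)%N%:Z - m)]%SET|%:R)%:E.
Proof.
move=> N0; rewrite secular_moment_cint; congr (_%:E).
rewrite -count_moment_content natr_sum.
rewrite (eq_cint mu (secular_norm_expand K.+1 m)).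
have bP (i j : {ffun 'I_K.+1 -> 'I_N.+1}) :
    cbmfun (fun U : T => (\prod_c sec (mx U) (moment_content i j c)) * twist K.+1 U).
  by apply: cbmfunM; [exact: cbmfun_prod_sec|exact: cbmfun_twist].
rewrite cint_sum => [|i _]; last by apply: cbmfun_sum => j _.
rewrite raddf_sum; apply: eq_bigr => i /eqP im.
rewrite cint_sum => [|j _]//; rewrite raddf_sum natr_sum; apply: eq_bigr => j /eqP jm.
have ij : (\sum_a i a = \sum_a j a)%N by apply: (can_inj absz_nat); rewrite im jm.
have -> : cint mu (fun U : T => (\prod_c sec (mx U) (moment_content i j c)) * twist K.+1 U) =
    kostka R[i] N K.+1 (moment_content i j).
  by rewrite -(moment_kostka haar N0 (sum_moment_content ij)).
by rewrite kostka_chain raddfMn.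
Qed.
End Moment.

Theorem theorem1p4 (R : realType) (k N : nat) (m : int)
    (hk : (1 <= k)%N) (hN : (1 <= N)%N)
    (mu : probability (borel_unitary R N) R) (hmu : is_haar mu) :
  secular_moment mu k m = (#|` fset_set (@lattice_points k N m)|%:R)%:E.
Proof.
case: k hk => // K _.
by rewrite secular_moment_chains// card_lattice_points.
Qed.
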